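(* Let $K$ be an infinite field and let $\mathbf{X}$ be a good $\Delta$-variety over $K$ which is bounded in the sense that there exist finite-dimensional $K$-vector spaces $W_1,W_2$ such that $\mathbf{X}(W_1,W_2)\neq \mathbf{V}(W_1,W_2)$. Then there exist an $n_{\mathbf{X}}\in\mathbb{N}$ and finite-dimensional $K$-vector spaces $U_1,\ldots,U_{n_{\mathbf{X}}}$ such that $\mathbf{X}$ equals the inclusion-wise largest good $\Delta$-variety $\mathbf{Y}$ with $\mathbf{Y}(U_1,\ldots,U_{n_{\mathbf{X}}})=\mathbf{X}(U_1,\ldots,U_{n_{\mathbf{X}}})$.
   Context: $\mathbb{N}=\{1,2,\ldots\}$ and $[n]=\{1,\ldots,n\}$. $K$ is an infinite field. For a tuple $(V_1,\ldots,V_n)$ of finite-dimensional $K$-vector spaces write $\mathbf{V}(V_1,\ldots,V_n):=V_1^*\otimes\cdots\otimes V_n^*$. There are three types of maps between these spaces: (1) for linear maps $f_i:V_i\to W_i$ ($i\in[n]$), the linear map $\bigotimes_i f_i^*:\mathbf{V}(W_1,\ldots,W_n)\to\mathbf{V}(V_1,\ldots,V_n)$, the tensor product of the dual maps; (2) for $\sigma\in\mathrm{Sym}([n])$, the canonical isomorphism $\sigma:\mathbf{V}(V_{\sigma(1)},\ldots,V_{\sigma(n)})\to\mathbf{V}(V_1,\ldots,V_n)$ permuting tensor factors; (3) the canonical flattening map $\mathbf{V}(V_1,\ldots,V_n,V_{n+1})\to\mathbf{V}(V_1,\ldots,V_{n-1},V_n\otimes V_{n+1})$. A $\Delta$-variety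 is a rule $\mathbf{X}$ that assigns to every finite sequence $(V_1,\ldots,V_n)$ of finite-dimensional $K$-vector spaces a subvariety (Zariski-closed subset, possibly empty) $\mathbf{X}(V_1,\ldots,V_n)$ of $\mathbf{V}(V_1,\ldots,V_n)$ such that each of the three types of maps preserves $\mathbf{X}$: $\bigotimes_i f_i^*$ maps $\mathbf{X}(W_1,\ldots,W_n)$ into $\mathbf{X}(V_1,\ldots,V_n)$; $\sigma$ maps $\mathbf{X}(V_{\sigma(1)},\ldots,V_{\sigma(n)})$ into $\mathbf{X}(V_1,\ldots,V_n)$; and the flattening map sends $\mathbf{X}(V_1,\ldots,V_{n+1})$ into $\mathbf{X}(V_1,\ldots,V_{n-1},V_n\otimes V_{n+1})$. A $\Delta$-variety $\mathbf{X}$ is good if, in addition, for all $(V_1,\ldots,V_n)$ the inverse of the isomorphism $\mathbf{V}(V_1,\ldots,V_n,K)\to\mathbf{V}(V_1,\ldots,V_n\otimes K)=\mathbf{V}(V_1,\ldots,V_n)$ maps $\mathbf{X}(V_1,\ldots,V_n)$ into $\mathbf{X}(V_1,\ldots,V_n,K)$. Inclusion of $\Delta$-varieties is instance-wise: $\mathbf{Z}\subseteq\mathbf{Y}$ means $\mathbf{Z}(V_1,\ldots,V_n)\subseteq\mathbf{Y}(V_1,\ldots,V_n)$ for all $(V_1,\ldots,V_n)$. *)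

(* Defs.v *)
From HB Require Import structures.
From mathcomp Require Import all_boot all_order all_algebra all_fingroup.
From mathcomp Require Import boolp classical_sets functions cardinality.
From mathcomp Require Import mpoly.

Set Implicit Arguments.
Unset Strict Implicit.
Unset Printing Implicit Defensive.

Import GRing.Theory.
Local Open Scope classical_set_scope.
Local Open Scope ring_scope.

Section Tensor.
Variable K : fieldType.

Definition dual (V : vectType K) : vectType K := 'Hom(V, K^o).

Definition basis (V : vectType K) (i : 'I_(\dim {:V})) : V := (vbasis {:V})`_i.
Definition coor (V : vectType K) (i : 'I_(\dim {:V})) (v : V) : K :=
  coord (vbasis {:V}) i v.

Section Family.
Variables (I : finType) (V : I -> vectType K).

(* The tensor product of the V i, as arrays of coordinates with respect to the
   products of the bases [basis (V := V i)].  It is a tensor product by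
   [pure_multilinear], [tensor_lift_pure] and [tensor_ext] below. *)
Definition tindex : finType := {dffun forall i : I, 'I_(\dim {:V i})}.
Definition tensor : vectType K := {ffun tindex -> K^o}.

Definition pure (v : forall i, V i) : tensor :=
  [ffun j : tindex => \prod_i coor (j i) (v i)].

Definition multilinear (T : vectType K) (g : (forall i, V i) -> T) : Prop :=
  forall (v : forall i, V i) (i : I) (a : K) (x y : V i),
    g (dfwith v (a *: x + y)) = a *: g (dfwith v x) + g (dfwith v y).

(* The linear map through which a multilinear g factors. *)
Definition tensor_lift (T : vectType K) (g : (forall i, V i) -> T) :
    'Hom(tensor, T) :=
  linfun (fun t : tensor => \sum_(j : tindex) t j *: g (fun i => basis (j i))).

End Family.

Section Binary.
Variables V W : vectType K.

Definition tensor2 : vectType K := tensor (fun b : bool => if b then V else W).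

Definition dual_tensor (f : dual V) (g : dual W) : dual tensor2 :=
  tensor_lift (T := K^o)
    (fun u : forall b : bool, (if b then V else W) => f (u true) * g (u false)).

End Binary.

(* V_1^* \otimes ... \otimes V_n^* *)
Definition cotensor n (V : 'I_n -> vectType K) : vectType K :=
  tensor (fun i => dual (V i)).

Definition cotensor_map n (V W : 'I_n -> vectType K)
    (f : forall i, 'Hom(V i, W i)) : 'Hom(cotensor W, cotensor V) :=
  tensor_lift (fun phi : forall i, dual (W i) =>
    pure (fun i => (phi i \o f i)%VF : dual (V i))).

(* Permuting coordinates amounts to permuting tensor factors:
   see [cotensor_perm_pure]. *)
Definition cotensor_perm n (V : 'I_n -> vectType K) (s : 'S_n) :
    'Hom(cotensor (fun i => V (s i)), cotensor V) :=
  linfun (fun t : cotensor (fun i => V (s i)) =>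
    [ffun j : tindex (fun i => dual (V i)) =>
       t [ffun i => j (s i)]] : cotensor V).

Section Flatten.
Variables (m : nat) (V : 'I_m.+2 -> vectType K).

Definition penult : 'I_m.+2 := lift ord_max ord_max.

Definition flat_fam (i : 'I_m.+1) : vectType K :=
  if unlift ord_max i is Some j then V (lift ord_max (lift ord_max j))
  else tensor2 (V penult) (V ord_max).

Definition flat_duals (phi : forall i, dual (V i)) (i : 'I_m.+1) :
    dual (flat_fam i) :=
  match unlift ord_max i as o return
    dual (if o is Some j then V (lift ord_max (lift ord_max j))
          else tensor2 (V penult) (V ord_max)) with
  | Some j => phi (lift ord_max (lift ord_max j))
  | None => dual_tensor (phi penult) (phi ord_max)
  end.

Definition cotensor_flatten : 'Hom(cotensor V, cotensor flat_fam) :=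
  tensor_lift (fun phi : forall i, dual (V i) => pure (flat_duals phi)).

End Flatten.

Section Unit.
Variables (n : nat) (V : 'I_n -> vectType K).

(* V_1, ..., V_n, K *)
Definition unit_fam (i : 'I_n.+1) : vectType K :=
  if unlift ord_max i is Some j then V j else K^o.

Definition unit_duals (phi : forall i, dual (V i)) (i : 'I_n.+1) :
    dual (unit_fam i) :=
  match unlift ord_max i as o return
    dual (if o is Some j then V j else K^o) with
  | Some j => phi j
  | None => \1%VF
  end.

(* phi_1 \otimes ... \otimes phi_n |-> phi_1 \otimes ... \otimes phi_n
   \otimes 1.  Flattening the right-hand side gives the last factor
   v \otimes c |-> phi_n(v) c, which is phi_n under V_n \otimes K = V_n; so this
   is the inverse of the isomorphism V(V_1, .., V_n, K) -> V(V_1, .., V_n). *)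
Definition cotensor_unit : 'Hom(cotensor V, cotensor unit_fam) :=
  tensor_lift (fun phi : forall i, dual (V i) => pure (unit_duals phi)).

End Unit.

Definition zariski_closed (T : vectType K) (S : set T) : Prop :=
  exists P : set {mpoly K[\dim {:T}]},
    S = [set t | forall p, P p -> p.@[fun i => coor i t] = 0].

(* The sequences (V_1, ..., V_n) are nonempty, n >= 1, and are indexed by
   0, ..., n - 1; the first argument of a rule is n - 1. *)
Definition rule : Type :=
  forall (n : nat) (V : 'I_n.+1 -> vectType K), set (cotensor V).

Record delta_variety (X : rule) : Prop := DeltaVariety {
  delta_closed : forall n (V : 'I_n.+1 -> vectType K),
    zariski_closed (X n V);
  delta_map : forall n (V W : 'I_n.+1 -> vectType K)
      (f : forall i, 'Hom(V i, W i)),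
    cotensor_map f @` X n W `<=` X n V;
  delta_perm : forall n (V : 'I_n.+1 -> vectType K) (s : 'S_n.+1),
    cotensor_perm V s @` X n (fun i => V (s i)) `<=` X n V;
  delta_flatten : forall n (V : 'I_n.+2 -> vectType K),
    cotensor_flatten V @` X n.+1 V `<=` X n (flat_fam V)
}.

Definition good_delta_variety (X : rule) : Prop :=
  delta_variety X /\
  forall n (V : 'I_n.+1 -> vectType K),
    cotensor_unit V @` X n V `<=` X n.+1 (unit_fam V).

Definition delta_sub (Z Y : rule) : Prop :=
  forall n (V : 'I_n.+1 -> vectType K), Z n V `<=` Y n V.

Definition bounded (X : rule) : Prop :=
  exists W : 'I_2 -> vectType K, X 1%N W <> setT.

Definition largest_rule (P : rule -> Prop) (X : rule) : Prop :=
  P X /\ forall Y, P Y -> delta_sub Y X.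

(* The universal property of [tensor] and the values of the
   structure maps on pure tensors. *)

Lemma sum_coor (V : vectType K) (v : V) : v = \sum_i coor i v *: basis i.
Proof. exact: (coord_vbasis (memvf v)). Qed.

Lemma coor_basis (V : vectType K) (i j : 'I_(\dim {:V})) :
  coor i (basis j) = (i == j)%:R.
Proof.
by rewrite /coor /basis coord_free ?(basis_free (vbasisP _)) // eq_sym.
Qed.

Section Universal.
Variables (I : finType) (V : I -> vectType K).
Implicit Type T : vectType K.

Lemma dfwith_id (v : forall i, V i) i : dfwith v (v i) = v.
Proof. by apply: functional_extensionality_dep => j; case: dfwithP. Qed.

Lemma pure_multilinear : multilinear (@pure I V).
Proof.
move=> v i a x y; apply/ffunP => j; rewrite !ffunE.
rewrite !(bigD1 i (P := predT)) //= !dfwith_in.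
have E (z : V i) : \prod_(k | k != i) coor (j k) (dfwith v z k) =
           \prod_(k | k != i) coor (j k) (v k).
  by apply: eq_bigr => k ki; rewrite dfwith_out 1?eq_sym.
rewrite !E /coor linearP /= mulrDl /GRing.scale /= mulrA.
by [].
Qed.

Lemma tensor_liftE T (g : (forall i, V i) -> T) (t : tensor V) :
  tensor_lift g t = \sum_(j : tindex V) t j *: g (fun i => basis (j i)).
Proof.
pose h (t : tensor V) := \sum_(j : tindex V) t j *: g (fun i => basis (j i)).
have hl : linear h.
  move=> a x y; rewrite /h scaler_sumr -big_split; apply: eq_bigr => j _ /=.
  by rewrite !ffunE scalerDl scalerA.
pose H := GRing.isLinear.Build K (tensor V) T _ h hl.
pose hL : {linear tensor V -> T} := HB.pack h H.
exact: (lfunE hL t).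
Qed.

Lemma pure_basis (j : tindex V) :
  pure (fun i => basis (j i)) = [ffun k => (k == j)%:R] :> tensor V.
Proof.
apply/ffunP => k; rewrite !ffunE; under eq_bigr do rewrite coor_basis.
case: eqP => [->|/eqP kj]; first by rewrite big1 // => i _; rewrite eqxx.
have [i ki] : exists i, k i != j i.
  apply/existsP; apply: contraNT kj; rewrite negb_exists => /forallP kj.
  by apply/eqP/ffunP => i; apply/eqP; have := kj i; rewrite negbK.
by rewrite (bigD1 i) //= (negPf ki) mul0r.
Qed.

Lemma tensor_sum_pure (t : tensor V) :
  t = \sum_(j : tindex V) t j *: pure (fun i => basis (j i)).
Proof.
apply/ffunP => k; rewrite sum_ffunE (bigD1 k) //= big1 ?addr0 => [|j jk].
  by rewrite pure_basis !ffunE eqxx /GRing.scale /= mulr1.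
by rewrite pure_basis !ffunE eq_sym (negPf jk) /GRing.scale /= mulr0.
Qed.

Lemma tensor_ext T (f g : 'Hom(tensor V, T)) :
  (forall v, f (pure v) = g (pure v)) -> f = g.
Proof.
move=> fg; apply/lfunP => t; rewrite (tensor_sum_pure t) !linear_sum.
by apply: eq_bigr => j _; rewrite !linearZ /= fg.
Qed.

Lemma multilinear_comp T (U : vectType K) (h : 'Hom(T, U)) (g : (forall i, V i) -> T) :
  multilinear g -> multilinear (fun v => h (g v)).
Proof. by move=> gm v i a x y; rewrite gm linearP. Qed.

Lemma multilinear_sum T (g : (forall i, V i) -> T) v i
    (J : finType) (a : J -> K) (x : J -> V i) :
  multilinear g ->
  g (dfwith v (\sum_j a j *: x j)) = \sum_j a j *: g (dfwith v (x j)).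
Proof.
move=> gm; have g0 : g (dfwith v (0 : V i)) = 0.
  have := gm v i (-1) 0 0.
  by rewrite scaleN1r oppr0 addr0 scaleN1r addNr.
elim/big_rec2: _ => // j y z _ <-; exact: gm.
Qed.

Lemma multilinear_eq T (g h : (forall i, V i) -> T) :
  multilinear g -> multilinear h ->
  (forall j : tindex V, g (fun i => basis (j i)) = h (fun i => basis (j i))) ->
  forall v, g v = h v.
Proof.
move=> gm hm ghb.
suff gh (s : seq I) v :
    (forall i, i \notin s -> exists k, v i = basis k) -> g v = h v.
  by move=> v; apply: (gh (enum I)) => i; rewrite mem_enum.
elim: s v => [|i s IH] v vb.
  have [k kv] : {k : forall i, 'I_(\dim {:V i}) | forall i, v i = basis (k i)}.
    have vb' i : {k | v i = basis k}.
      exact/constructive_indefinite_description/vb.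
    by exists (fun i => sval (vb' i)) => i; apply: (svalP (vb' i)).
  have -> : v = fun i => basis ([ffun i => k i] i : 'I_(\dim {:V i})).
    by apply: functional_extensionality_dep => i; rewrite ffunE kv.
  exact: (ghb [ffun i => k i]).
rewrite -(dfwith_id v i) (sum_coor (v i)) !multilinear_sum //.
apply: eq_bigr => k _; congr (_ *: _); apply: IH => i'.
case: dfwithP => [_|i'' ii'' i''s]; first by exists k.
by apply: vb; rewrite inE negb_or eq_sym ii''.
Qed.

Lemma tensor_lift_pure T (g : (forall i, V i) -> T) :
  multilinear g -> forall v, tensor_lift g (pure v) = g v.
Proof.
move=> gm; apply: (multilinear_eq (g := fun v => tensor_lift g (pure v))) => //.
  exact: (multilinear_comp _ pure_multilinear).
move=> j; rewrite pure_basis tensor_liftE (bigD1 j) //= big1 ?addr0 => [|k kj].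
  by rewrite ffunE eqxx scale1r.
by rewrite ffunE (negPf kj) scale0r.
Qed.

Lemma pure_linear_at (u x y : forall i, V i) (i : I) (a : K) :
  u i = a *: x i + y i ->
  (forall k, k != i -> u k = x k /\ u k = y k) ->
  pure u = a *: pure x + pure y.
Proof.
move=> ui uk; apply/ffunP => j; rewrite !ffunE !(bigD1 i (P := predT)) //= ui.
have -> : \prod_(k | k != i) coor (j k) (x k) =
          \prod_(k | k != i) coor (j k) (u k).
  by apply: eq_bigr => k /uk[<-].
have -> : \prod_(k | k != i) coor (j k) (y k) =
          \prod_(k | k != i) coor (j k) (u k).
  by apply: eq_bigr => k /uk[_ <-].
by rewrite /coor linearP /= mulrDl /GRing.scale /= mulrA.
Qed.

End Universal.

Lemma dual_tensor_pure (V W : vectType K) (f : dual V) (g : dual W)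
    (u : forall b : bool, if b then V else W) :
  dual_tensor f g (pure u) = f (u true) * g (u false).
Proof.
rewrite /dual_tensor tensor_lift_pure // => {}u [] a x y.
- by rewrite !dfwith_in !dfwith_out // linearP mulrDl /GRing.scale /= mulrA.
- by rewrite !dfwith_in !dfwith_out // linearP mulrDr /GRing.scale /= mulrCA.
Qed.

Lemma dual_tensorDl (V W : vectType K) a (f f' : dual V) (g : dual W) :
  dual_tensor (a *: f + f') g = a *: dual_tensor f g + dual_tensor f' g.
Proof.
apply: tensor_ext => u; rewrite !lfunE /= !lfunE /= !dual_tensor_pure.
by rewrite !lfunE /= !lfunE /= mulrDl /GRing.scale /= mulrA.
Qed.

Lemma dual_tensorDr (V W : vectType K) a (f : dual V) (g g' : dual W) :
  dual_tensor f (a *: g + g') = a *: dual_tensor f g + dual_tensor f g'.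
Proof.
apply: tensor_ext => u; rewrite !lfunE /= !lfunE /= !dual_tensor_pure.
by rewrite !lfunE /= !lfunE /= mulrDr /GRing.scale /= mulrCA.
Qed.

Lemma cotensor_map_pure n (V W : 'I_n -> vectType K)
    (f : forall i, 'Hom(V i, W i)) (phi : forall i, dual (W i)) :
  cotensor_map f (pure phi) = pure (fun i => (phi i \o f i)%VF : dual (V i)).
Proof.
apply: tensor_lift_pure => {}phi i a x y.
apply: (pure_linear_at (i := i)).
  by rewrite !dfwith_in comp_lfunDl comp_lfunZl.
by move=> k; rewrite eq_sym => ki; rewrite !dfwith_out.
Qed.

Lemma cotensor_perm_pure n (V : 'I_n -> vectType K) (s : 'S_n)
    (phi : forall i, dual (V i)) :
  cotensor_perm V s (pure (fun i => phi (s i))) = pure phi.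
Proof.
pose h (t : cotensor (fun i => V (s i))) : cotensor V :=
  [ffun j : tindex (fun i => dual (V i)) => t [ffun i => j (s i)]].
have hl : linear h by move=> a x y; apply/ffunP => j; rewrite !ffunE.
pose H := GRing.isLinear.Build K _ _ _ h hl.
pose hL : {linear cotensor (fun i => V (s i)) -> cotensor V} := HB.pack h H.
rewrite [LHS](lfunE hL) /= /h; apply/ffunP => j; rewrite !ffunE.
by rewrite [RHS](reindex_inj (@perm_inj _ s)); apply: eq_bigr => i _; rewrite ffunE.
Qed.

Lemma cotensor_flatten_pure m (V : 'I_m.+2 -> vectType K)
    (phi : forall i, dual (V i)) :
  cotensor_flatten V (pure phi) = pure (flat_duals phi).
Proof.
apply: tensor_lift_pure => {}phi i a x y.
case: (unliftP ord_max i) x y => [i' ->|->] x y; last first.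
  apply: (pure_linear_at (i := ord_max)) => [|k].
    rewrite /flat_duals /flat_fam unlift_none !dfwith_in.
    by rewrite !dfwith_out ?neq_lift // dual_tensorDr.
  case: (unliftP ord_max k) => [k' -> _|->]; last by rewrite eqxx.
  by rewrite /flat_duals /flat_fam liftK !dfwith_out ?neq_lift.
case: (unliftP ord_max i') x y => [i'' ->|->] x y; last first.
  apply: (pure_linear_at (i := ord_max)) => [|k].
    rewrite /flat_duals /flat_fam unlift_none !dfwith_in.
    by rewrite !dfwith_out ?[_ == ord_max]eq_sym ?neq_lift // dual_tensorDl.
  case: (unliftP ord_max k) => [k' -> _|->]; last by rewrite eqxx.
  have pk : penult m != lift ord_max (lift ord_max k').
    by apply/eqP => /lift_inj/eqP; apply/negP/neq_lift.
  by rewrite /flat_duals /flat_fam liftK !dfwith_out.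
apply: (pure_linear_at (i := lift ord_max i'')) => [|k].
  by rewrite /flat_duals /flat_fam liftK !dfwith_in.
case: (unliftP ord_max k) => [k' ->|-> _].
  move=> ki; have ik : lift ord_max (lift ord_max i'') !=
      lift ord_max (lift ord_max k') :> 'I_m.+2.
    by apply: contra_neq ki => /lift_inj ->.
  by rewrite /flat_duals /flat_fam liftK !dfwith_out.
have ip : lift ord_max (lift ord_max i'') != penult m.
  by apply: contra_neq (neq_lift ord_max i'') => /lift_inj.
have im : lift ord_max (lift ord_max i'') != ord_max by rewrite eq_sym neq_lift.
by rewrite /flat_duals /flat_fam unlift_none !dfwith_out.
Qed.

Lemma cotensor_unit_pure n (V : 'I_n -> vectType K)
    (phi : forall i, dual (V i)) :
  cotensor_unit V (pure phi) = pure (unit_duals phi).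
Proof.
apply: tensor_lift_pure => {}phi i a x y.
apply: (pure_linear_at (i := lift ord_max i)) => [|k].
  by rewrite /unit_duals /unit_fam liftK !dfwith_in.
case: (unliftP ord_max k) => [k' ->|-> _].
  move=> ki; have ik : i != k' by apply: contra_neq ki => ->.
  by rewrite /unit_duals /unit_fam liftK !dfwith_out.
by rewrite /unit_duals /unit_fam unlift_none.
Qed.

End Tensor.

(* Main.v *)
From mathcomp Require Import finmap ring mpoly.
Require Import Defs.
From HB Require Import structures.
From mathcomp Require Import all_boot all_order all_algebra all_fingroup.
From mathcomp Require Import boolp classical_sets functions cardinality.

(** If no instance determined X, there would be good Delta-varieties Y_l agreeing
with X on ever larger instances, with tensors t_l in Y_l outside X, and polynomials
f_l vanishing on X but not at t_l.  For k < l every image of t_l in the space of t_k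
lies in X, so f_k vanishes at all these images: (t_l, f_l) is a bad sequence.

Let W be the bounding pair of spaces and D its first member.  All two-block
flattenings of elements of X and Y_l have rank < dim D, so each tensor can be moved
to tensor powers of D.  A bad sequence of tensors of flattening rank <= r is excluded
by induction on r.  If infinitely many ranks are < r, pass to them.  Otherwise, as K
is infinite, each t_l has a nonsingular r x r block in which all but boundedly many
positions are contracted with fixed vectors x_j.  The vanishing of the minors of size
r + 1 then writes t_l as a tensor train: its entries are fixed polynomials in a base
vector and one letter of a fixed affine space per remaining position, and contracting
a position with x_j deletes its letter.  This yields a bad sequence of polynomials on
words of letters, up to deletion of letters.  It is excluded by choosing, for the
fixed points, polynomials with lexicographically minimal leading monomials:
by Higman's lemma one leading monomial embeds into a later one, and a subtraction
makes the later leading monomial smaller. *)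

Set Implicit Arguments.
Unset Strict Implicit.
Unset Printing Implicit Defensive.

Import GRing.Theory.

(** * Well-quasi-orders *)

Section Subsequences.

Definition increasing (e : nat -> nat) := forall i, e i < e i.+1.

Lemma increasing_lt e i j : increasing e -> i < j -> e i < e j.
Proof.
by move=> eI; apply: (@homo_ltn nat e (fun x y => x < y)) => // y x z; apply: ltn_trans. Qed.

Lemma increasing_comp e e' :
  increasing e -> increasing e' -> increasing (e \o e').
Proof. by move=> eI e'I i; exact: increasing_lt (e'I i). Qed.

Lemma infinite_subseq (Q : nat -> Prop) :
  (forall N, exists2 l, N <= l & Q l) ->
  exists2 e, increasing e & forall i, Q (e i).
Proof.
move=> H.
have [g gP] : {g : nat -> nat | forall N, N <= g N /\ Q (g N)}.
  have H' N : exists l, N <= l /\ Q l by have [l] := H N; exists l.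
  by have [g gP] := choice H'; exists g.
pose e := fix e i := if i is j.+1 then g (e j).+1 else g 0.
exists e => [i|[|i]] /=; [exact: (gP _).1|exact: (gP _).2|exact: (gP _).2].
Qed.

Lemma infinite_pigeonhole (F : finType) (Q : nat -> F -> Prop) :
  (forall l, exists v, Q l v) ->
  exists v, forall N, exists2 l, N <= l & Q l v.
Proof.
move=> H; apply: contrapT => /forallNP nH.
have [N NP] : {N : F -> nat & forall v l, N v <= l -> ~ Q l v}.
  apply: (choice (P := fun v N => forall l, N <= l -> ~ Q l v)) => v.
  have /existsNP[N nN] := nH v.
  by exists N => l Nl Qlv; apply: nN; exists l.
have [v Qv] := H (\max_v N v).
exact: NP (leq_bigmax v) Qv.
Qed.

Lemma nat_min (P : nat -> Prop) :
  (exists n, P n) -> exists2 n, P n & forall m, P m -> n <= m.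
Proof.
move=> [n Pn]; have ex : exists n, `[< P n >] by exists n; apply/asboolP.
case: (ex_minnP ex) => m /asboolP Pm mP; exists m => // k Pk.
by apply: mP; apply/asboolP.
Qed.

(** Keep the indices whose value is minimal among all later ones; every tail attains its minimum, so
    there are infinitely many. *)
Lemma nat_nondecreasing_subseq (f : nat -> nat) :
  exists2 e, increasing e & forall i j, i <= j -> f (e i) <= f (e j).
Proof.
have [|e eI eP] := @infinite_subseq (fun l => forall j, l <= j -> f l <= f j).
  move=> N; have [|v [l [Nl <-]] lP] := nat_min (P := fun v => exists l, N <= l /\ f l = v).
    by exists (f N), N.
  exists l => // j lj; apply: lP; exists j; split => //; exact: leq_trans lj.
exists e => // i j; rewrite leq_eqVlt => /orP[/eqP->//|ij].
exact/eP/ltnW/increasing_lt.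
Qed.

Lemma dickson (C : finType) (f : nat -> {ffun C -> nat}) :
  exists2 e, increasing e &
    forall i j, i <= j -> forall c, f (e i) c <= f (e j) c.
Proof.
suff [e eI eP] : exists2 e, increasing e &
    forall i j, i <= j -> forall c, c \in enum C -> f (e i) c <= f (e j) c.
  by exists e => // i j ij c; apply: eP => //; rewrite mem_enum.
elim: (enum C) => [|c s [e eI eP]]; first by exists id.
have [e' e'I e'P] := nat_nondecreasing_subseq (fun i => f (e i) c).
exists (e \o e'); first exact: increasing_comp.
move=> i j ij c'; rewrite inE => /orP[/eqP->|c's]; first exact: e'P.
apply: eP => //; move: ij; rewrite leq_eqVlt => /orP[/eqP->//|ij].
exact/ltnW/increasing_lt.
Qed.

End Subsequences.

(** * Higman's lemma *)

Section Higman.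
Variables (A : Type) (le : A -> A -> Prop).

Inductive embeds : seq A -> seq A -> Prop :=
| embeds_nil : embeds [::] [::]
| embeds_cons x y s t : le x y -> embeds s t -> embeds (x :: s) (y :: t)
| embeds_skip y s t : embeds s t -> embeds s (y :: t).

Lemma embeds_nil_l s : embeds [::] s.
Proof. by elim: s => [|x s]; constructor. Qed.

Definition bad_words (f : nat -> seq A) :=
  forall i j, i < j -> ~ embeds (f i) (f j).

(** Choose the words one by one, each as short as possible among the bad sequences that continue the
    words already chosen. *)
Lemma minimal_bad_words (f0 : nat -> seq A) : bad_words f0 ->
  exists2 f, bad_words f &
    forall g n, bad_words g -> (forall i, i < n -> g i = f i) ->
      size (f n) <= size (g n).
Proof.
move=> bad0.
pose ext (s : seq (seq A)) f := bad_words f /\ forall i, i < size s -> f i = nth [::] s i.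
pose T := {s : seq (seq A) | exists f, ext s f}.
have step (s : T) : exists x : seq A, (exists f, ext (rcons (sval s) x) f) /\
    forall f, ext (sval s) f -> size x <= size (f (size (sval s))).
  have [|v [f [fE <-]] fP] := nat_min
    (P := fun v => exists f, ext (sval s) f /\ size (f (size (sval s))) = v).
    by have [f fE] := svalP s; exists (size (f (size (sval s)))), f.
  exists (f (size (sval s))); split; last by move=> g gE; apply: fP; exists g.
  exists f; split=> [|i]; first exact: fE.1.
  rewrite size_rcons ltnS nth_rcons leq_eqVlt => /orP[/eqP->|ilt].
    by rewrite ltnn eqxx.
  by rewrite ilt; apply: fE.2.
have [nx nxP] := choice step.
have t0 : exists f, ext [::] f by exists f0.
pose p := fix p n : T := if n is m.+1 then exist _ _ (nxP (p m)).1
  else exist _ [::] t0.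
have sp n : size (sval (p n)) = n by elim: n => //= n IH; rewrite size_rcons IH.
pose f n := nx (p n).
have pf n i : i < n -> nth [::] (sval (p n)) i = f i.
  elim: n => // n IH; rewrite ltnS leq_eqVlt /= nth_rcons sp => /orP[/eqP->|ilt].
    by rewrite ltnn eqxx.
  by rewrite ilt IH.
exists f => [i j ij|g n gB gf].
  have [g [gB gE]] := svalP (p j.+1).
  have ij' : i < j.+1 by exact: ltn_trans ij (ltnSn j).
  by rewrite -(pf j.+1 i ij') -(pf j.+1 j) // -!gE ?sp //; exact: gB.
have := (nxP (p n)).2 g; rewrite sp; apply; split=> // i; rewrite sp => iltn.
by rewrite pf ?gf.
Qed.

(** Nash-Williams: in a minimal bad sequence, cutting off the heads along a subsequence with
    increasing heads gives a bad sequence whose first changed word is shorter. *)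
Lemma higman :
  (forall f : nat -> A, exists2 e, increasing e &
     forall i j, i < j -> le (f (e i)) (f (e j))) ->
  forall f : nat -> seq A, exists i j, i < j /\ embeds (f i) (f j).
Proof.
move=> wqo f0; apply: contrapT => nex.
have bad0 : bad_words f0.
  by move=> i j ij ef; apply: nex; exists i, j.
have [f fB fmin] := minimal_bad_words bad0.
have fcons n : exists xs, f n = xs.1 :: xs.2.
  case E : (f n) => [|x s]; last by exists (x, s).
  by case: (fB n n.+1) => //; rewrite E; exact: embeds_nil_l.
have [xs xsP] := choice fcons.
have [e eI eP] := wqo (fun n => (xs n).1).
pose g n := if n < e 0 then f n else (xs (e (n - e 0))).2.
suff gB : bad_words g.
  have := fmin g (e 0) gB; rewrite /g ltnn subnn xsP /= ltnn => H.
  by suff : false by []; apply: H => i ->.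
move=> i j ij; rewrite /g; case: (ltnP j (e 0)) => je.
  by rewrite (ltn_trans ij je); exact: fB.
case: (ltnP i (e 0)) => ie.
  move=> H; have : embeds (f i) (f (e (j - e 0))) by rewrite (xsP (e _)); constructor.
  apply: fB; apply: leq_trans ie _.
  case: (posnP (j - e 0)) => [->//|jp]; exact/ltnW/increasing_lt.
have ij' : i - e 0 < j - e 0 by rewrite ltn_sub2r // (leq_ltn_trans ie).
move=> H; have : embeds (f (e (i - e 0))) (f (e (j - e 0))).
  by rewrite !xsP; constructor => //; exact: eP.
exact/fB/increasing_lt.
Qed.

End Higman.

(** * Polynomials on words of letters *)

Section Lexicographic.
Variables (A : Type) (lt : A -> A -> Prop).

Fixpoint lexlt (s t : seq A) : Prop :=
  match s, t with
  | a :: s', b :: t' => lt a b \/ a = b /\ lexlt s' t'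
  | _, _ => False
  end.

Lemma lexlt_trans : (forall b a c, lt a b -> lt b c -> lt a c) ->
  forall t s u, lexlt s t -> lexlt t u -> lexlt s u.
Proof.
move=> tr; elim=> [|b t IH] [|a s] [|c u] //=.
move=> [ab|[-> st]] [bc|[<- tu]]; [left|left|by left|right].
- exact: tr bc.
- by [].
- by split=> //; apply: IH tu.
Qed.

Lemma lexlt_total : (forall a b, lt a b \/ a = b \/ lt b a) ->
  forall s t, size s = size t -> lexlt s t \/ s = t \/ lexlt t s.
Proof.
move=> tot; elim=> [|a s IH] [|b t] //=; first by right; left.
case=> st; case: (tot a b) => [ab|[<-|ba]]; [by left; left| |by right; right; left].
case: (IH t st) => [lst|[->|lts]]; [by left; right|by right; left|].
by right; right; right.
Qed.

Definition has_minima := forall P : A -> Prop,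
  (exists a, P a) -> exists2 a, P a & forall b, P b -> ~ lt b a.

(** The length is fixed, since words of unbounded length admit infinite lexicographic descents:
    minimize the head, then the tail behind this head. *)
Lemma lexlt_min : has_minima -> forall n (P : seq A -> Prop),
  (exists2 s, size s = n & P s) ->
  exists s, [/\ size s = n, P s & forall t, size t = n -> P t -> ~ lexlt t s].
Proof.
move=> mn; elim=> [|n IH] P [s0 ns0 Ps0].
  by exists s0; split=> // t /size0nil-> _ [].
case: s0 ns0 Ps0 => // a0 s0 [ns0] Ps0.
have [|a [s1 ns1 Ps1] amin] := mn (fun a => exists2 s, size s = n & P (a :: s)).
  by exists a0, s0.
have [|s [ns Ps smin]] := IH (fun s => P (a :: s)); first by exists s1.
exists (a :: s); split=> [|//|[//|b t] [nt] Pt]; first by rewrite /= ns.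
case=> [ba|[ba ts]]; first by apply: amin ba; exists t.
by apply: smin ts => //; rewrite -ba.
Qed.

End Lexicographic.

(** * Polynomial functions *)

Section PolynomialFunctions.
Variables (K : fieldType) (A I : Type) (x : I -> A -> K).
Local Open Scope ring_scope.

(** The algebra of functions generated by the coordinates [x]; [A] need not be an affine space, and
    below it can consist of words of all lengths. *)
Inductive polyfun : (A -> K) -> Prop :=
| polyfun_const c : polyfun (fun=> c)
| polyfun_var i : polyfun (x i)
| polyfun_add f g : polyfun f -> polyfun g -> polyfun (fun a => f a + g a)
| polyfun_mul f g : polyfun f -> polyfun g -> polyfun (fun a => f a * g a).

Lemma polyfun_sum (J : Type) (s : seq J) (f : J -> A -> K) :
  (forall j, polyfun (f j)) -> polyfun (fun a => \sum_(j <- s) f j a).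
Proof.
move=> fP; elim: s => [|j s IH].
  by under eq_fun do rewrite big_nil; exact: polyfun_const.
by under eq_fun do rewrite big_cons; apply: polyfun_add.
Qed.

Lemma polyfun_prod (J : Type) (s : seq J) (f : J -> A -> K) :
  (forall j, polyfun (f j)) -> polyfun (fun a => \prod_(j <- s) f j a).
Proof.
move=> fP; elim: s => [|j s IH].
  by under eq_fun do rewrite big_nil; exact: polyfun_const.
by under eq_fun do rewrite big_cons; apply: polyfun_mul.
Qed.

Lemma polyfun_exp n (f : A -> K) : polyfun f -> polyfun (fun a => f a ^+ n).
Proof.
move=> fP; elim: n => [|n IH].
  by under eq_fun do rewrite expr0; exact: polyfun_const.
by under eq_fun do rewrite exprS; apply: polyfun_mul.
Qed.

End PolynomialFunctions.

Lemma polyfun_comp (K : fieldType) (A B I J : Type) (x : I -> A -> K)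
    (y : J -> B -> K) (h : A -> B) (f : B -> K) :
  polyfun y f -> (forall j, polyfun x (fun a => y j (h a))) ->
  polyfun x (fun a => f (h a)).
Proof.
move=> fP hP; elim: fP => [c|j|g g' _ IH _ IH'|g g' _ IH _ IH'].
- exact: polyfun_const.
- exact: hP.
- exact: polyfun_add.
- exact: polyfun_mul.
Qed.

(** A selection from a selection is again a selection, uniformly in the sequence. *)
Lemma mask_mask b b' : count id b = size b' ->
  exists b'', [/\ size b'' = size b, count id b'' = count id b' &
    forall T (s : seq T), size s = size b -> mask b' (mask b s) = mask b'' s].
Proof.
elim: b b' => [|[] b IH] b' /=.
- by case: b' => // _; exists [::]; split=> // T [].
- case: b' => //= c b' [/IH[b'' [s1 s2 s3]]]; exists (c :: b''); split=> /=.
  + by rewrite s1.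
  + by rewrite s2.
  + by move=> T [//|y s] [/s3 E]; case: c => /=; rewrite E.
- move=> /IH[b'' [s1 s2 s3]]; exists (false :: b''); split=> /=.
  + by rewrite s1.
  + by rewrite s2.
  + by move=> T [//|y s] [/s3 E]; rewrite /= E.
Qed.

(** * Noetherianity of polynomials on words up to deletion of letters *)

Section WideMatrices.
Variables (K : fieldType) (C : finType).
Local Open Scope ring_scope.

Notation expo := {ffun C -> nat}.
Notation letter := (C -> K).
Notation word := (seq expo).

Definition emon (e : expo) (x : letter) : K := \prod_c x c ^+ e c.

Fixpoint wmon (w : word) (T : seq letter) : K :=
  match w, T with
  | e :: w', x :: T' => emon e x * wmon w' T'
  | _, _ => 1
  end.

Definition eadd (e f : expo) : expo := [ffun c => (e c + f c)%N].
Definition ele (e f : expo) : Prop := forall c, (e c <= f c)%N.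
Definition elt (e f : expo) : Prop :=
  lexlt (fun a b : nat => (a < b)%N) [seq e c | c <- enum C] [seq f c | c <- enum C].
Definition wlt : word -> word -> Prop := lexlt elt.

Lemma emonD e f x : emon (eadd e f) x = emon e x * emon f x.
Proof. by rewrite -big_split /=; apply: eq_bigr => c _; rewrite ffunE exprD. Qed.

Lemma elt_add e e' f : elt e e' -> elt (eadd e f) (eadd e' f).
Proof.
rewrite /elt; elim: (enum C) => //= c s IH; rewrite !ffunE ltn_add2r.
by case=> [|[-> /IH]]; [left|right].
Qed.

Lemma eq_expo (e f : expo) :
  [seq e c | c <- enum C] = [seq f c | c <- enum C] -> e = f.
Proof. by move=> /eq_in_map ef; apply/ffunP => c; rewrite ef ?mem_enum. Qed.

Lemma elt_trans f e g : elt e f -> elt f g -> elt e g.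
Proof. by apply: lexlt_trans => b a c; apply: ltn_trans. Qed.

Lemma elt_total e f : elt e f \/ e = f \/ elt f e.
Proof.
have tot (a b : nat) : (a < b)%N \/ a = b \/ (b < a)%N.
  by case: (ltngtP a b) => [|| ->]; [left|right; right|right; left].
have sz : size [seq e c | c <- enum C] = size [seq f c | c <- enum C].
  by rewrite !size_map.
case: (lexlt_total tot sz) => [|[/eq_expo|]]; [by left|by right; left|by right; right].
Qed.

Lemma elt_min : has_minima elt.
Proof.
move=> P [expo0 Pe0].
have mn : has_minima (fun a b : nat => (a < b)%N).
  move=> Q [n Qn]; have [|m Qm mP] := nat_min (P := Q); first by exists n.
  by exists m => // k /mP; rewrite leqNgt => /negP.
have [|s [_ [e Pe <-] smin]] := lexlt_min mn (n := #|C|)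
    (P := fun s => exists2 e, P e & [seq e c | c <- enum C] = s).
  by exists [seq expo0 c | c <- enum C]; [rewrite size_map cardE|exists expo0].
exists e => // f Pf fe; apply: smin fe; first by rewrite size_map cardE.
by exists f.
Qed.

Lemma wlt_trans v u w : wlt u v -> wlt v w -> wlt u w.
Proof. exact/lexlt_trans/elt_trans. Qed.

Lemma wlt_total u v : size u = size v -> wlt u v \/ u = v \/ wlt v u.
Proof. exact/lexlt_total/elt_total. Qed.

(* An embedding of w into w' induces a strictly monotone map Sh on the words of
   the size of w such that the monomial Sh u is a fixed multiple q of the
   monomial u evaluated at the letters selected by b. *)
Definition divides_along (b : bitseq) (w w' : word) : Prop :=
  [/\ size b = size w', count id b = size w & exists Sh q,
    [/\ Sh w = w',
        forall u, size u = size w -> size (Sh u) = size w',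
        forall u v, size u = size w -> size v = size w -> wlt u v -> wlt (Sh u) (Sh v) &
        forall u T, size u = size w -> size T = size w' ->
          wmon (Sh u) T = q T * wmon u (mask b T)]].

Lemma divides_along_cons b e e' w w' : ele e e' ->
  divides_along b w w' -> divides_along (true :: b) (e :: w) (e' :: w').
Proof.
move=> ee' [sb cb [Sh [q [Shw sSh ltSh monSh]]]].
(* Exponent of the quotient of the two head monomials; the truncated subtraction is exact by
   [ele e e']. *)
pose f : expo := [ffun c => (e' c - e c)%N].
split=> /=; [by rewrite sb|by rewrite cb|].
exists (fun u => if u is a :: u' then eadd a f :: Sh u' else [::]).
exists (fun T => if T is z :: T' then emon f z * q T' else 1); split.
- rewrite Shw; congr (_ :: _); apply/ffunP => c.
  by rewrite !ffunE subnKC.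
- by move=> [//|a u] [/sSh] /= ->.
- move=> [//|a u] [//|a' v] [su] [sv] /= [lt|[-> lt]]; [left|right].
    exact: elt_add.
  by split=> //; apply: ltSh.
- move=> [//|a u] [//|z T] [su] [sT] /=.
  by rewrite monSh // emonD [emon a z * _]mulrC mulrACA.
Qed.

(** A matched letter multiplies by the quotient of the two monomials; a skipped letter of [w'] is
    inserted into every word and contributes its monomial to [q]. *)
Lemma embeds_divides_along w w' :
  embeds ele w w' -> exists b, divides_along b w w'.
Proof.
elim=> [|e e' s t ee' _ [b IH]|y s t _ [b [sb cb [Sh [q [Shw sSh ltSh monSh]]]]]].
- exists [::]; split=> //; exists id, (fun=> 1); split=> // u T.
  by move=> /size0nil-> /size0nil->; rewrite mul1r.
- by exists (true :: b); apply: divides_along_cons.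
- exists (false :: b); split=> /=; [by rewrite sb|by rewrite cb|].
  exists (fun u => y :: Sh u).
  exists (fun T => if T is z :: T' then emon y z * q T' else 1); split.
  + by rewrite Shw.
  + by move=> u /sSh /= ->.
  + by move=> u v su sv lt; right; split=> //; apply: ltSh.
  + by move=> u [//|z T] su [sT] /=; rewrite monSh // mulrA.
Qed.

(** Functions that have some expression as a combination of the monomials in [Q]. Working with
    expressions avoids showing that monomials are linearly independent. *)
Inductive mspan (Q : word -> Prop) : (seq letter -> K) -> Prop :=
| mspan0 : mspan Q (fun=> 0)
| mspan_cons c w g : Q w -> mspan Q g -> mspan Q (fun T => c * wmon w T + g T).

Lemma mspan_sub (Q Q' : word -> Prop) g :
  (forall w, Q w -> Q' w) -> mspan Q g -> mspan Q' g.
Proof. by move=> QQ'; elim=> [|c w g' /QQ' Qw _ IH]; constructor. Qed.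

Lemma mspan_add Q f g : mspan Q f -> mspan Q g -> mspan Q (fun T => f T + g T).
Proof.
move=> fP gP; elim: fP => [|c w f' Qw _ IH].
  by under eq_fun do rewrite add0r.
by under eq_fun do rewrite -addrA; constructor.
Qed.

Lemma mspan_scale Q a g : mspan Q g -> mspan Q (fun T => a * g T).
Proof.
elim=> [|c w f' Qw _ IH]; first by under eq_fun do rewrite mulr0; constructor.
by under eq_fun do rewrite mulrDr mulrA; constructor.
Qed.

Definition wcoord (p : nat * C) (T : seq letter) : K := nth (fun=> 0) T p.1 p.2.

Definition wadd (u v : word) : word := [seq eadd p.1 p.2 | p <- zip u v].

Lemma size_wadd u v n : size u = n -> size v = n -> size (wadd u v) = n.
Proof. by move=> su sv; rewrite size_map size_zip su sv minnn. Qed.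

Lemma wmonD u v T : size u = size T -> size v = size T ->
  wmon (wadd u v) T = wmon u T * wmon v T.
Proof.
elim: u v T => [|a u IH] [|a' v] [|z T] //=; first by rewrite mulr1.
by move=> [su] [sv]; rewrite emonD IH // mulrACA.
Qed.

Definition expo0 : expo := [ffun=> 0%N].

Lemma emon_expo0 x : emon expo0 x = 1.
Proof. by rewrite /emon big1 // => c _; rewrite ffunE. Qed.

Lemma wmon0 n T : wmon (nseq n expo0) T = 1.
Proof. by elim: n T => [|n IH] [|z T] //=; rewrite emon_expo0 IH mulr1. Qed.

Lemma wcoord_mspan p n : exists2 g, mspan (fun w => size w = n) g &
  forall T, size T = n -> wcoord p T = g T.
Proof.
case: p => j c; case: (ltnP j n) => jn; last first.
  exists (fun=> 0); first exact: mspan0.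
  by move=> T sT; rewrite /wcoord nth_default ?sT.
pose w := nseq j expo0 ++ [ffun c' => (c' == c : nat)] :: nseq (n - j.+1) expo0.
exists (fun T => 1 * wmon w T + 0).
  apply: mspan_cons; last exact: mspan0.
  by rewrite size_cat /= !size_nseq addnS -addSn subnKC.
move=> T sT; rewrite addr0 mul1r /w /wcoord /= {w}.
elim: j n T jn sT => [|j IH] [|n] [|z T] //= jn.
  move=> [sT]; rewrite wmon0 mulr1 /emon (bigD1 c) //= big1 => [|c' /negPf c'c].
    by rewrite ffunE eqxx mulr1.
  by rewrite ffunE c'c.
by move=> [sT]; rewrite emon_expo0 mul1r subSS; apply: IH.
Qed.

(** On words of one length the product of two word monomials is a word monomial, so products of
    combinations expand again. *)
Lemma polyfun_mspan f n : polyfun wcoord f ->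
  exists2 g, mspan (fun w => size w = n) g & forall T, size T = n -> f T = g T.
Proof.
elim=> [c|p|f1 f2 _ [g1 P1 E1] _ [g2 P2 E2]|f1 f2 _ [g1 P1 E1] _ [g2 P2 E2]].
- exists (fun T => c * wmon (nseq n expo0) T + 0).
    by apply: mspan_cons; [rewrite size_nseq|exact: mspan0].
  by move=> T _; rewrite wmon0 mulr1 addr0.
- exact: wcoord_mspan.
- exists (fun T => g1 T + g2 T); first exact: mspan_add.
  by move=> T sT; rewrite E1 ?E2.
- suff [g gP gE] : exists2 g, mspan (fun w => size w = n) g &
      forall T, size T = n -> g1 T * g2 T = g T.
    by exists g => // T sT; rewrite E1 ?E2 ?gE.
  elim: P1 => [|c w h sw _ [g gP gE]] {E1 f1 g1}.
    by exists (fun=> 0) => [|T _]; [exact: mspan0|rewrite mul0r].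
  suff [g' g'P g'E] : exists2 g, mspan (fun w => size w = n) g &
      forall T, size T = n -> wmon w T * g2 T = g T.
    exists (fun T => c * g' T + g T); first by apply/mspan_add => //; apply: mspan_scale.
    by move=> T sT; rewrite mulrDl gE // -mulrA g'E.
  elim: P2 => [|c' w' h' sw' _ [g' g'P g'E]] {E2 f2 g2 gE}.
    by exists (fun=> 0) => [|T _]; [exact: mspan0|rewrite mulr0].
  exists (fun T => c' * wmon (wadd w w') T + g' T).
    by apply: mspan_cons => //; apply: size_wadd.
  by move=> T sT; rewrite mulrDr g'E // wmonD ?sw ?sw' // mulrCA.
Qed.

(** Compare each new term with the largest one so far. The coefficient [c] is allowed to be 0. *)
Lemma mspan_lead n (Q : word -> Prop) g :
  (forall w, Q w -> size w = n) -> mspan Q g ->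
  (forall T, g T = 0) \/
  exists mu c g', [/\ Q mu, mspan (fun w => size w = n /\ wlt w mu) g' &
    forall T, g T = c * wmon mu T + g' T].
Proof.
move=> Qn; elim=> [|c w f Qw _ [f0|[mu [c' [g' [Qmu g'P fE]]]]]]; first by left.
  right; exists w, c, (fun=> 0); split=> // [|T]; first exact: mspan0.
  by rewrite f0.
right; case: (@wlt_total w mu); first by rewrite !Qn.
  move=> lt; exists mu, c', (fun T => c * wmon w T + g' T); split=> // [|T].
    by apply: mspan_cons => //; split=> //; apply: Qn.
  by rewrite fE addrCA.
case=> [E|lt].
  exists mu, (c + c'), g'; split=> // T.
  by rewrite fE E addrA mulrDl.
exists w, c, (fun T => c' * wmon mu T + g' T); split=> // [|T].
  apply: mspan_cons; first by split=> //; apply: Qn.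
  by apply: mspan_sub g'P => v [sv vmu]; split=> //; apply: wlt_trans lt.
by rewrite fE.
Qed.

Lemma mspan_shift b w w' Sh q g :
  [/\ Sh w = w',
      forall u, size u = size w -> size (Sh u) = size w',
      forall u v, size u = size w -> size v = size w -> wlt u v -> wlt (Sh u) (Sh v) &
      forall u T, size u = size w -> size T = size w' ->
        wmon (Sh u) T = q T * wmon u (mask b T)] ->
  mspan (fun u => size u = size w /\ wlt u w) g ->
  exists2 g', mspan (fun u => size u = size w' /\ wlt u w') g' &
    forall T, size T = size w' -> g' T = q T * g (mask b T).
Proof.
move=> [Shw sSh ltSh monSh]; elim=> [|c u f [su uw] _ [g' g'P g'E]].
  by exists (fun=> 0) => [|T _]; [exact: mspan0|rewrite mulr0].
exists (fun T => c * wmon (Sh u) T + g' T).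
  by apply: mspan_cons => //; split; [exact: sSh|rewrite -Shw; apply: ltSh].
by move=> T sT; rewrite g'E // monSh // mulrDr mulrCA.
Qed.

(* For fixed points T, choose each polynomial with the smallest possible leading
   monomial; if the k-th leading monomial embeds into the l-th one, subtracting a
   multiple of the k-th polynomial from the l-th one gives a smaller choice. *)
Theorem wide_matrices_noetherian (T : nat -> seq letter)
    (f : nat -> seq letter -> K) :
  (forall l, 0 < size (T l))%N -> (forall l, polyfun wcoord (f l)) ->
  (forall l, f l (T l) <> 0) ->
  (forall k l b, (k < l)%N -> size b = (size (T l)).-1 ->
     count id b = (size (T k)).-1 -> f k (mask (true :: b) (T l)) = 0) ->
  False.
Proof.
move=> Tpos fP fT fmask.
pose n l := size (T l).
(* What [g] retains from [f l]: it is nonzero at [T l] and vanishes at the selections from later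
   words that have the size of [T l] and keep the head letter. *)
pose good l (g : seq letter -> K) := g (T l) <> 0 /\ forall j b, (l < j)%N ->
  size b = (n j).-1 -> count id b = (n l).-1 -> g (mask (true :: b) (T j)) = 0.
have sT l : size (T l) = (n l).-1.+1 by rewrite (prednK (Tpos l)).
have smask l j b : size b = (n j).-1 -> count id b = (n l).-1 ->
    size (mask (true :: b) (T j)) = n l.
  move=> sb cb; rewrite size_mask /=; last by rewrite sb -sT.
  by rewrite cb add1n -sT.
have good_eq l g g' : (forall S, size S = n l -> g S = g' S) -> good l g -> good l g'.
  move=> E [gT gm]; split=> [|j b lj sb cb]; first by rewrite -E.
  by rewrite -E ?gm //; apply: smask cb.
pose LD l mu := exists c g', mspan (fun u => size u = n l /\ wlt u mu) g' /\
  good l (fun S => c * wmon mu S + g' S).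
have LD_of l Q g : (forall w, Q w -> size w = n l) -> mspan Q g -> good l g ->
    exists2 mu, Q mu & LD l mu.
  move=> Qn gP gG; case: (mspan_lead Qn gP) => [g0|[mu [c [g' [Qmu g'P gE]]]]].
    by case: gG; rewrite g0.
  by exists mu => //; exists c, g'; split=> //; apply: good_eq gG => S _.
have [mu muP] : {mu : nat -> word & forall l, [/\ size (mu l) = n l, LD l (mu l) &
    forall t, size t = n l -> LD l t -> ~ wlt t (mu l)]}.
  apply: (choice (P := fun l mu => [/\ size mu = n l, LD l mu &
    forall t, size t = n l -> LD l t -> ~ wlt t mu])) => l.
  apply: (lexlt_min elt_min); have [g gP gE] := polyfun_mspan (n l) (fP l).
  have gG : good l g.
    by apply: (good_eq l (f l)) => //; split=> // j b lj sb cb; apply: fmask.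
  by apply: LD_of gP gG => // w ->.
(* By minimality of [mu l], no good polynomial has all its terms below [mu l]. *)
have low l g : mspan (fun u => size u = n l /\ wlt u (mu l)) g -> ~ good l g.
  move=> gP gG; have [|nu [snu ltnu] LDnu] := LD_of l _ g _ gP gG; first by move=> w [].
  by have [_ _ /(_ nu snu LDnu)] := muP l.
have [ew ewP] : {ew : nat -> expo * word & forall l, mu l = (ew l).1 :: (ew l).2}.
  apply: (choice (P := fun l p => mu l = p.1 :: p.2)) => l.
  case E : (mu l) => [|e w]; last by exists (e, w).
  by have [s0 _ _] := muP l; have := Tpos l; rewrite -/(n l) -s0 E.
(* The head letter is never deleted, so head exponents are compared by Dickson's lemma and only the
   tails by Higman's. *)
have [e eI eP] := dickson (fun l => (ew l).1).
have wqo (h : nat -> expo) : exists2 e, increasing e &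
    forall i j, (i < j)%N -> ele (h (e i)) (h (e j)).
  by have [e' ? e'P] := dickson h; exists e' => // i j /ltnW /e'P.
have [i [j [ij emb]]] := higman wqo (fun i => (ew (e i)).2).
move: (increasing_lt eI ij) emb (eP i j (ltnW ij)).
move: (e i) (e j) => k l kl emb le_e {i j ij e eI eP wqo}.
have [b /(divides_along_cons le_e)] := embeds_divides_along emb.
rewrite -!ewP => -[sb cb [Sh [q ShP]]].
have [sk [ck [gk [gkP [gkT gkm]]]] _] := muP k.
have [sl [cl [gl [glP [glT glm]]]] _] := muP l.
rewrite sk in cb; rewrite sl in sb.
have sb' : size b = (n l).-1 by rewrite -sb.
have cb' : count id b = (n k).-1 by rewrite -cb.
(* Otherwise [gk] alone would be good, with all terms below [mu k]. *)
have ck0 : ck != 0.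
  apply/negP => /eqP c0; apply: (low k gk gkP); 
  apply: (good_eq k (fun S => ck * wmon (mu k) S + gk S)) => //.
  by move=> S _; rewrite c0 mul0r add0r.
have [|g' g'P g'E] := mspan_shift (g := gk) ShP; first by rewrite sk.
rewrite sl in g'P g'E; case: ShP => Shk _ _ monSh.
(* Subtract the multiple of the k-th polynomial, taken at the selected letters, that cancels the
   term at [mu l]. *)
apply: (low l (fun S => gl S + - (cl / ck) * g' S)).
  by apply: mspan_add => //; apply: mspan_scale.
have GE S : size S = n l -> gl S + - (cl / ck) * g' S =
    (cl * wmon (mu l) S + gl S) -
    cl / ck * q S * (ck * wmon (mu k) (mask (true :: b) S) + gk (mask (true :: b) S)).
  move=> sS; rewrite g'E // -Shk monSh ?sl // mulrDr opprD addrACA mulNr.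
  have -> : cl / ck * q S * (ck * wmon (mu k) (mask (true :: b) S)) =
      cl * (q S * wmon (mu k) (mask (true :: b) S)).
    by rewrite -!mulrA [q S * (ck * _)]mulrCA mulKf.
  by rewrite subrr add0r mulrA.
split=> [|i b2 li sb2 cb2].
  by rewrite GE // gkm // mulr0 subr0.
rewrite GE ?(smask l) // glm // sub0r.
(* At later words, selecting by [b2] and then by [b] is a single selection, at which the k-th
   polynomial vanishes. *)
have [|b3 [sb3 cb3 b3E]] := @mask_mask b2 b; first by rewrite cb2.
case Ti : (T i) (sT i) => [//|z U] [sU].
have -> : mask (true :: b) (mask (true :: b2) (z :: U)) = mask (true :: b3) (z :: U).
  by rewrite /= b3E // sU.
by rewrite -Ti gkm ?mulr0 ?oppr0 ?(ltn_trans kl) ?sb3 ?cb3.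
Qed.

End WideMatrices.

(** * Flattening ranks *)

Section Minors.
Variables (K : fieldType) (I : finType) (V : I -> Type).
Local Open Scope ring_scope.

Definition mix (A : pred I) (a b : forall i, V i) : forall i, V i :=
  fun i => if A i then a i else b i.

Definition flat_block (t : (forall i, V i) -> K) (A : pred I) r
    (a b : 'I_r -> forall i, V i) : 'M[K]_r :=
  \matrix_(i, j) t (mix A (a i) (b j)).

(* All flattenings of t along a splitting of I into two parts have rank < r. *)
Definition flat_rank_lt (t : (forall i, V i) -> K) r : Prop :=
  forall A (a b : 'I_r -> forall i, V i), \det (flat_block t A a b) = 0.

(** Eliminating [u] with [M] leaves the Schur complement, a scalar, as the second factor of the
    determinant. *)
Lemma det_schur r (M : 'M[K]_r) (c : 'cV_r) (u : 'rV_r) (s : 'M_1) :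
  M \in unitmx -> \det (block_mx M c u s) = 0 -> s = u *m invmx M *m c.
Proof.
move=> Mu; have -> : block_mx M c u s =
    block_mx 1%:M 0 (u *m invmx M) 1%:M *m block_mx M c 0 (s - u *m invmx M *m c).
  by rewrite mulmx_block !mul1mx !mul0mx !addr0 mulmxKV // subrKC.
rewrite det_mulmx det_lblock det_ublock !det1 !mul1r => /eqP.
rewrite mulf_eq0 (negPf (_ : \det M != 0)) /=; last by rewrite -unitfE -unitmxE.
rewrite [_ - _]mx11_scalar det_scalar1 => /eqP E; apply/eqP.
by rewrite -subr_eq0 [_ - _]mx11_scalar E raddf0.
Qed.

(** Border the nonsingular block by the row [u] and the column [v]: the determinant vanishes, so the
    new corner entry is determined by the rest. *)
Lemma flat_rank_schur t r A (a b : 'I_r -> forall i, V i) u v :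
  (forall a' b' : 'I_(r + 1) -> forall i, V i, \det (flat_block t A a' b') = 0) ->
  \det (flat_block t A a b) != 0 ->
  t (mix A u v) = \sum_i \sum_j
    t (mix A u (b j)) * invmx (flat_block t A a b) j i * t (mix A (a i) v).
Proof.
move=> rk; rewrite -unitfE -unitmxE; set M := flat_block _ _ _ _ => Mu.
pose a' (i : 'I_(r + 1)) := if fintype.split i is inl i' then a i' else u.
pose b' (i : 'I_(r + 1)) := if fintype.split i is inl i' then b i' else v.
have := rk a' b'.
have -> : flat_block t A a' b' = block_mx M (\col_i t (mix A (a i) v))
   (\row_j t (mix A u (b j))) (t (mix A u v))%:M.
  apply/matrixP => i j; rewrite !mxE /a' /b'.
  case: (fintype.split i) => i'; rewrite !mxE; case: (fintype.split j) => j'; rewrite !mxE //.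
  by rewrite (ord1 i') (ord1 j') eqxx.
move=> /(det_schur Mu) /matrixP/(_ 0 0); rewrite !mxE eqxx mulr1n => ->.
apply: eq_bigr => i _; rewrite !mxE mulr_suml.
by apply: eq_bigr => j _; rewrite !mxE.
Qed.

End Minors.

(** * Nonsingular blocks that vary in few positions *)

Section Positions.
Variables (K : fieldType) (K_infinite : infinite_set [set: K]).
Variables (D : vectType K) (I : finType).
Local Open Scope ring_scope.

Notation tuples := (I -> D).
Notation upd a k x := (@dfwith I (fun=> D : Type) a k x).

Lemma exists_nonroot (p : {poly K}) : p != 0 -> exists x, p.[x] != 0.
Proof.
move=> p0; have [B _ sB] := infinite_set_fset (size p) K_infinite.
apply: contrapT => /forallNP nex.
have : (size (enum_fset B) < size p)%N.
  apply: max_poly_roots (fset_uniq B) => //; apply/allP => x _.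
  by apply/rootP/eqP/negPn/negP/nex.
by rewrite ltnNge sB.
Qed.

(** Weaker than multilinearity: it survives fixing the vectors at some positions. *)
Definition coord_affine (w : tuples -> K) := forall a k x y (l : K),
  w (upd a k (x + l *: (y - x))) = w (upd a k x) + l * (w (upd a k y) - w (upd a k x)).

Lemma det_line_poly r (G : K -> 'M[K]_r) (G0 G1 : 'M_r) :
  (forall l, G l = G0 + l *: G1) -> exists p : {poly K}, forall l, p.[l] = \det (G l).
Proof.
move=> GE; exists (\det (map_mx polyC G0 + 'X *: map_mx polyC G1)) => l.
rewrite -horner_evalE -det_map_mx; congr (\det _); rewrite GE.
by apply/matrixP => i j; rewrite !mxE /= !horner_evalE !hornerE.
Qed.

Lemma mix_upd (N : {set I}) (a z : tuples) k x : k \notin N ->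
  mix (mem N) a (upd z k x) = upd (mix (mem N) a z) k x.
Proof.
move=> kN; apply: funext => i; rewrite /mix; case: (eqVneq k i) => [<-|ki].
  by rewrite /= (negPf kN) !dfwith_in.
by rewrite !dfwith_out.
Qed.

Lemma upd_id (z : tuples) k : upd z k (z k) = z.
Proof. by apply: funext => i; case: (eqVneq k i) => [<-|ki]; rewrite ?dfwith_in ?dfwith_out. Qed.

Definition diff_out (N : {set I}) (z y : tuples) := [set k | (k \notin N) && (z k != y k)].

(* The points z and y approach each other one coordinate at a time, along lines on
   which both nonvanishing conditions hold generically. *)
Lemma position_walk r (w : 'I_r -> tuples -> K) (h : tuples -> K)
    (N : {set I}) (a : 'I_r -> tuples) (z y : tuples) :
  (forall j, coord_affine (w j)) -> coord_affine h ->
  let Dz z := \det (\matrix_(i, j) w j (mix (mem N) (a i) z)) in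
  Dz z != 0 -> (forall i, h (mix (mem N) (a i) z) = 0) -> h y != 0 ->
  exists z' y', [/\ Dz z' != 0, forall i, h (mix (mem N) (a i) z') = 0,
    h y' != 0 & (#|diff_out N z' y'| <= 1)%N].
Proof.
move=> wA hA Dz; have [m] := ubnP #|diff_out N z y|.
elim: m z y => // m IH z y zym zN0 hz hy0.
case: (leqP #|diff_out N z y| 1) => [le1|gt1]; first by exists z, y.
have [k] : exists k, k \in diff_out N z y by apply/card_gt0P/ltnW.
rewrite inE => /andP[kN zyk].
pose zl l := upd z k (z k + l *: (y k - z k)).
pose yl l := upd y k (z k + l *: (y k - z k)).
have [p pE] : exists p : {poly K}, forall l, p.[l] = Dz (zl l).
  apply: (@det_line_poly _ _ (\matrix_(i, j) w j (mix (mem N) (a i) z))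
    (\matrix_(i, j) (w j (upd (mix (mem N) (a i) z) k (y k)) - w j (mix (mem N) (a i) z)))).
  move=> l; apply/matrixP => i j; rewrite !mxE mix_upd // wA.
  by rewrite -[upd (mix _ _ z) k (z k)]mix_upd // upd_id.
pose q : {poly K} := (h (upd y k (z k)))%:P + 'X * (h y - h (upd y k (z k)))%:P.
have qE l : q.[l] = h (yl l) by rewrite /yl hA upd_id !hornerE.
have p0 : p != 0.
  apply: contra_neq zN0 => p0; have := pE 0.
  by rewrite p0 horner0 /zl scale0r addr0 upd_id.
have q0 : q != 0.
  apply: contra_neq hy0 => q0; have := qE 1.
  by rewrite q0 horner0 /yl scale1r subrKC upd_id.
have [l] := exists_nonroot (mulf_neq0 p0 q0).
rewrite hornerM mulf_eq0 negb_or pE qE => /andP[zl0 yl0].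
(* If [h] still vanishes on the rows, one difference fewer remains; otherwise a row where it does
   not serves as [y'], and outside [N] it differs from [z] at most at [k]. *)
case: (pselect (forall i, h (mix (mem N) (a i) (zl l)) = 0)) => [hzl|].
  apply: (IH (zl l) (yl l)) => //; apply: (leq_trans _ (zym : (_ <= m)%N)).
  apply: proper_card; apply/properP; split.
    apply/fintype.subsetP => i; rewrite !inE /zl /yl => /andP[->] /=.
    by case: (eqVneq k i) => [<-|ki]; rewrite ?dfwith_in ?eqxx ?dfwith_out.
  by exists k; rewrite !inE ?kN // /zl /yl !dfwith_in eqxx.
move=> /existsNP[i /eqP hi]; exists z, (mix (mem N) (a i) (zl l)); split=> //.
rewrite -(cards1 k); apply/subset_leq_card/fintype.subsetP => j; rewrite !inE.
case/andP=> jN; apply: contraNT; rewrite eq_sym => kj.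
by rewrite /mix /= (negPf jN) /zl dfwith_out.
Qed.

(** Induction on the size. Expanding along the first column, the last functions have a nonsingular
    block, in which few positions vary by induction. The first function is corrected so as to vanish
    on its rows; then [position_walk] supplies one more row at the cost of at most one more
    position. *)
Lemma few_positions r (w : 'I_r -> tuples -> K) (a : 'I_r -> tuples) :
  (forall j, coord_affine (w j)) -> \det (\matrix_(i, j) w j (a i)) != 0 ->
  exists (N : {set I}) a' z, (#|N| <= r)%N /\
    \det (\matrix_(i, j) w j (mix (mem N) (a' i) z)) != 0.
Proof.
elim: r w a => [|r IH] w a wA wa0.
  exists finset.set0, a, (fun=> 0); split; first by rewrite cards0.
  by rewrite det_mx00 oner_neq0.
set B := (\matrix_(i, j) _) in wa0.
have [i0 Bi0] : exists i, \det (row' i (col' ord0 B)) != 0.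
  apply: contrapT => /forallNP H; move: wa0; rewrite (expand_det_col _ ord0) big1 ?eqxx // => i _.
  by rewrite /cofactor; have /negP := H i; rewrite negbK => /eqP->; rewrite !mulr0.
have [||N [a' [z [Nr]]]] := IH (fun j => w (lift ord0 j)) (fun i => a (lift i0 i)).
- by move=> j; apply: wA.
- by apply: contra_neq Bi0 => <-; congr (\det _); apply/matrixP => i j; rewrite !mxE.
set M := (\matrix_(i, j) _) => M0.
have Mu : M \in unitmx by rewrite unitmxE unitfE.
have [c cE] : exists c : 'cV_r, M *m c = \col_i w ord0 (mix (mem N) (a' i) z).
  by exists (invmx M *m \col_i w ord0 (mix (mem N) (a' i) z)); rewrite mulKVmx.
pose h u := w ord0 u - \sum_j c j 0 * w (lift ord0 j) u.
have hA : coord_affine h.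
  move=> u k x y l; rewrite /h wA; under eq_bigr => j _ do rewrite wA mulrDr.
  rewrite big_split /=; under [X in _ - (_ + X)]eq_bigr => j _ do rewrite mulrCA mulrBr.
  by rewrite -mulr_sumr sumrB; ring.
have hz i : h (mix (mem N) (a' i) z) = 0.
  have /matrixP/(_ i 0) := cE; rewrite !mxE /h => <-; apply/eqP; rewrite subr_eq0; apply/eqP/eq_bigr => j _.
  by rewrite mxE mulrC.
have [y hy] : exists y, h y != 0.
  apply: contrapT => /forallNP H.
  pose v : 'cV[K]_r.+1 := \col_j oapp (fun j' => - c j' 0) 1 (unlift ord0 j).
  have Bv : B *m v = 0.
    apply/matrixP => i j; rewrite !mxE big_ord_recl !mxE unlift_none /= mulr1.
    have /negP := H (a i); rewrite negbK => /eqP hi; rewrite -[RHS]hi /h; congr (_ + _).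
    by rewrite -sumrN; apply: eq_bigr => j' _; rewrite !mxE liftK /= mulrN mulrC.
  have Bu : B \in unitmx by rewrite unitmxE unitfE.
  have : v = 0 by rewrite -(mulKmx Bu v) Bv mulmx0.
  move/matrixP/(_ ord0 0); rewrite !mxE unlift_none /= => /eqP.
  by rewrite oner_eq0.
have [|z' [y' [Mz' hz' hy' df]]] := position_walk (w := fun j => w (lift ord0 j)) _ hA M0 hz hy.
  by move=> j; apply: wA.
pose a'' i := if unlift ord0 i is Some i' then mix (mem N) (a' i') z' else y'.
exists (N :|: diff_out N z' y'), a'', z'; split.
  by rewrite (leq_trans (leq_card_setU _ _)) // -addn1 leq_add.
have mixa i : mix (mem (N :|: diff_out N z' y')) (a'' i) z' = a'' i.
  apply: funext => k; rewrite /mix /= !inE; case: ifPn => //.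
  rewrite negb_or negb_and negbK => /andP[kN]; rewrite (negPf kN) /= negbK => /eqP zy.
  by rewrite /a''; case: unlift => [i'|//]; rewrite /mix /= (negPf kN).
set B' := (\matrix_(i, j) _); apply: contra_neq (mulf_neq0 hy' Mz') => B'0.
(* This column operation puts the values of [h] into the first column and makes the matrix block
   triangular. *)
pose U : 'M[K]_(1 + r) := block_mx 1%:M 0 (- c) 1%:M.
have : \det ((B' : 'M_(1 + r)) *m U) = 0 by rewrite det_mulmx B'0 mul0r.
rewrite -[X in X *m U](@submxK _ 1 r 1 r B') mulmx_block !mulmx1 !mulmx0 add0r.
have a0 : a'' ord0 = y' by rewrite /a'' unlift_none.
have al i : a'' (lift ord0 i) = mix (mem N) (a' i) z' by rewrite /a'' liftK.
have -> : @dlsubmx _ 1 r 1 r B' + @drsubmx _ 1 r 1 r B' *m - c = 0.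
  apply/matrixP => i j; rewrite !mxE (ord1 j) lshift0 !rshift1 !mixa al.
  rewrite -[RHS](hz' i) /h; congr (_ + _).
  rewrite -sumrN; apply: eq_bigr => j' _.
  by rewrite !mxE !rshift1 mixa al mulrN mulrC.
have -> : @ulsubmx _ 1 r 1 r B' + @ursubmx _ 1 r 1 r B' *m - c = (h y')%:M.
  apply/matrixP => i j; rewrite !mxE (ord1 i) (ord1 j) !lshift0 !mixa a0 eqxx mulr1n.
  congr (_ + _); rewrite -sumrN; apply: eq_bigr => j' _.
  by rewrite !mxE !rshift1 !lshift0 mixa a0 mulrN mulrC.
rewrite det_ublock det_scalar1 add0r => <-; congr (_ * \det _).
by apply/matrixP => i j; rewrite !mxE !rshift1 mixa al.
Qed.

End Positions.

(** * Layouts of a tensor *)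

Section Layouts.
Variables (K : fieldType) (K_infinite : infinite_set [set: K]).
Variables (D : vectType K).
Local Open Scope ring_scope.

Notation upd I a k x := (@dfwith I (fun=> D : Type) a k x).
Notation multilin n t := (@multilinear K 'I_n (fun=> D) (K^o : vectType K) t).

Lemma multilinear_affine n (t : ('I_n -> D) -> K) :
  multilin n t -> coord_affine t.
Proof.
move=> tM a k x y l; rewrite addrC tM -[y - x]addrC -scaleN1r tM.
by rewrite scaleN1r /GRing.scale /= addrC; congr (_ + _ * _); rewrite addrC.
Qed.

Lemma coord_affine_mixl n (t : ('I_n -> D) -> K) A b :
  coord_affine t -> coord_affine (fun a => t (mix A a b)).
Proof.
move=> tA a k x y l; case Ak : (A k).
  have E z : mix A (upd _ a k z) b = upd _ (mix A a b) k z.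
    apply: funext => i; rewrite /mix; case: (eqVneq k i) => [<-|ki].
      by rewrite Ak !dfwith_in.
    by rewrite !dfwith_out.
  by rewrite !E tA.
have E z : mix A (upd _ a k z) b = mix A a b.
  apply: funext => i; rewrite /mix; case: (eqVneq k i) => [<-|ki].
    by rewrite Ak.
  by rewrite !dfwith_out.
by rewrite !E subrr mulr0 addr0.
Qed.

Lemma coord_affine_mixr n (t : ('I_n -> D) -> K) A a :
  coord_affine t -> coord_affine (fun b => t (mix A a b)).
Proof.
have E b : mix A a b = mix (predC A) b a.
  by apply: funext => i; rewrite /mix /=; case: (A i).
by move=> /(coord_affine_mixl (predC A) a) H b k x y l; rewrite !E H.
Qed.

Definition glue n (s : seq 'I_n) (u : seq D) : 'I_n -> D :=
  fun i => nth 0 u (index i s).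

Lemma glue_map n (s : seq 'I_n) (f : 'I_n -> D) :
  (forall i, i \in s) -> glue s (map f s) = f.
Proof.
move=> sA; apply: funext => i; rewrite /glue (nth_map i) ?index_mem //.
by rewrite nth_index.
Qed.

(* A nonsingular r x r block of a flattening of t in which only p row positions
   and q column positions vary. *)
Record layout n (t : ('I_n -> D) -> K) (r p q : nat) := Layout {
  rowpos : p.-tuple 'I_n;
  colpos : q.-tuple 'I_n;
  restpos : seq 'I_n;
  rowvec : 'I_r -> seq D;
  colvec : 'I_r -> seq D;
  restvec : seq D;
  pos := rowpos ++ colpos ++ restpos;
  ltensor := fun u => t (glue pos u);
  lblock := \matrix_(i, j) ltensor (rowvec i ++ colvec j ++ restvec);
  _ : [/\ uniq pos, forall i, i \in pos, forall i, size (rowvec i) = p,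
    forall j, size (colvec j) = q & size restvec = size restpos];
  _ : \det lblock != 0
}.

(** Reduce the varying positions of the rows with the columns fixed, then, after transposing, those
    of the columns. The two numbers of positions range over a finite type, ready for the pigeonhole
    principle. *)
Lemma exists_layout n (t : ('I_n -> D) -> K) r :
  multilin n t -> ~ flat_rank_lt t r ->
  exists v : 'I_r.+1 * 'I_r.+1, inhabited (layout t r v.1 v.2).
Proof.
move=> /multilinear_affine tA /existsNP[A /existsNP[a /existsNP[b /eqP ab]]].
have [|N [a' [z [Nr {}ab]]]] := few_positions K_infinite
  (w := fun j a => t (mix A a (b j))) (a := a) _ ab.
  by move=> j; apply: coord_affine_mixl.
rewrite -det_tr in ab.
have [||N' [b' [z' [N'r {}ab]]]] := few_positions K_infinite
  (w := fun i b => t (mix A (mix (mem N) (a' i) z) b)) (a := b).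
- by move=> i; apply: coord_affine_mixr.
- suff <- : (\matrix_(i, j) t (mix A (mix (mem N) (a' i) z) (b j)))^T =
    \matrix_(i, j) t (mix A (mix (mem N) (a' j) z) (b i)) by [].
  by apply/matrixP => i j; rewrite !mxE.
pose P := [set i in N | A i]; pose Q := [set i in N' | ~~ A i].
pose R := ~: (P :|: Q).
have Pr : (#|P| < r.+1)%N.
  by rewrite ltnS (leq_trans _ Nr) // subset_leq_card //; apply/fintype.subsetP => i; rewrite inE => /andP[].
have Qr : (#|Q| < r.+1)%N.
  by rewrite ltnS (leq_trans _ N'r) // subset_leq_card //; apply/fintype.subsetP => i; rewrite inE => /andP[].
exists (Ordinal Pr, Ordinal Qr); constructor => /=.
have dPQ i : i \in P -> i \in Q = false.
  by rewrite !inE => /andP[_ ->]; rewrite andbF.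
pose x := mix A z z'.
pose s := enum P ++ enum Q ++ enum R.
have sE i : i \in s by rewrite !mem_cat !mem_enum finset.in_setC finset.in_setU;
  case: (i \in P); case: (i \in Q).
have sU : uniq s.
  rewrite !cat_uniq !enum_uniq /= andbT; apply/andP; split.
    apply/hasPn => i; rewrite mem_cat !mem_enum finset.in_setC finset.in_setU.
    by case/orP => [iQ|]; [apply/negP => /dPQ; rewrite iQ|case: (i \in P)].
  by apply/hasPn => i; rewrite !mem_enum finset.in_setC finset.in_setU; case: (i \in Q); rewrite ?orbT.
have sizeP : size (enum P) == #|P| by rewrite -cardE.
have sizeQ : size (enum Q) == #|Q| by rewrite -cardE.
apply: (@Layout _ _ _ _ _ (Tuple sizeP) (Tuple sizeQ) (enum R)
  (fun i => map (a' i) (enum P)) (fun j => map (b' j) (enum Q)) (map x (enum R))).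
  split=> //; try by move=> i; rewrite size_map -cardE.
  by rewrite size_map.
rewrite -det_tr; apply: contraNneq ab => /= <-; apply/eqP; congr (\det _).
apply/matrixP => j i; rewrite !mxE; congr (t _).
pose g k := mix A (mix (mem N) (a' i) z) (mix (mem N') (b' j) z') k.
have -> : mix A (mix (mem N) (a' i) z) (mix (mem N') (b' j) z') = g by [].
rewrite -[LHS](glue_map (s := s)) // /s !map_cat; congr (glue _ (_ ++ (_ ++ _))).
- by apply/eq_in_map => k; rewrite mem_enum inE /g /mix /= => /andP[-> ->].
- by apply/eq_in_map => k; rewrite mem_enum inE /g /mix /= => /andP[-> /negPf->].
- apply/eq_in_map => k; rewrite mem_enum !inE negb_or !negb_and negbK /g /x /mix /=.
  by case: (A k); rewrite /= ?orbF ?orbT ?andbT => /negPf->.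
Qed.

End Layouts.

(** * Tensor trains *)

Section BitMix.
Variable (T : Type).

Definition bmix (A : bitseq) (u v : seq T) : seq T :=
  [seq (if z.1 then z.2.1 else z.2.2) | z <- zip A (zip u v)].

Lemma bmix_cat A1 A2 u1 u2 v1 v2 :
  size u1 = size A1 -> size v1 = size A1 ->
  bmix (A1 ++ A2) (u1 ++ u2) (v1 ++ v2) = bmix A1 u1 v1 ++ bmix A2 u2 v2.
Proof.
by move=> su sv; rewrite /bmix !zip_cat ?map_cat ?size_zip ?su ?sv ?minnn.
Qed.

Lemma bmix_true m u v : size u = m -> size v = m -> bmix (nseq m true) u v = u.
Proof. by elim: m u v => [|m IH] [|x u] [|y v] //= [su] [sv]; congr (_ :: _); apply: IH. Qed.

Lemma bmix_false m u v : size u = m -> size v = m -> bmix (nseq m false) u v = v.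
Proof. by elim: m u v => [|m IH] [|x u] [|y v] //= [su] [sv]; congr (_ :: _); apply: IH. Qed.

Lemma nth_bmix x0 A u v i : size u = size A -> size v = size A ->
  nth x0 (bmix A u v) i = if nth false A i then nth x0 u i else nth x0 v i.
Proof.
elim: A u v i => [|c A IH] [|x u] [|y v] [|i] //=; rewrite ?nth_nil //.
by move=> [su] [sv]; apply: IH.
Qed.

Fixpoint bmerge (b : bitseq) (w x : seq T) : seq T :=
  match b, x with
  | true :: b', _ :: x' => if w is c :: w' then c :: bmerge b' w' x' else [::]
  | false :: b', y :: x' => y :: bmerge b' w x'
  | _, _ => [::]
  end.

Lemma size_bmerge b w x : size b = size x -> count id b = size w ->
  size (bmerge b w x) = size x.
Proof.
elim: b w x => [|[] b IH] w [|y x] //= [sb].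
  by case: w => //= c w [cb]; rewrite IH.
by rewrite add0n => cb; rewrite IH.
Qed.

Lemma bmerge_true_cat m b u w x x' : size u = m -> size x = m ->
  bmerge (nseq m true ++ b) (u ++ w) (x ++ x') = u ++ bmerge b w x'.
Proof. by elim: m u x => [|m IH] [|c u] [|y x] //= [su] [sx]; rewrite IH. Qed.

Lemma nth_bmerge (I : eqType) x0 (s : seq I) b w x i : uniq s ->
  size b = size s -> size x = size s -> count id b = size w -> i \in s ->
  nth x0 (bmerge b w x) (index i s) =
  if i \in mask b s then nth x0 w (index i (mask b s)) else nth x0 x (index i s).
Proof.
elim: b s w x => [|[] b IH] [|j s] w [|y x] //= /andP[js sU] [sb] [sx].
  case: w => //= c w [cb]; rewrite !inE [i == j]eq_sym; case: eqVneq => //= _ is_.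
  by rewrite IH.
rewrite add0n inE eq_sym => cb; case: eqVneq => [<- _|_ /= is_]; last by rewrite IH.
by case: ifPn => // /mem_mask; rewrite (negPf js).
Qed.

End BitMix.

(** * Entries of a tensor from its letters *)

Section Train.
Variables (K : fieldType) (D : vectType K) (dl : nat) (e : 'I_dl -> D).
Variables (r p q : nat).
Local Open Scope ring_scope.

Notation multilin n t := (@multilinear K 'I_n (fun=> D) (K^o : vectType K) t).

(** A row: either vectors of the family [e] at the row positions or one of the rows of the block. *)
Definition rowarg : finType := (p.-tuple 'I_dl + 'I_r)%type.
(** On the left the entries of the base, on the right the transitions from a row and a vector at the
    next position to a row of the block. *)
Definition coordinate : finType := (rowarg * q.-tuple 'I_dl + rowarg * 'I_r * 'I_dl)%type.

(* [y 0] is the base; [y k] is the letter of the head of w, and the letters of the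
   next positions follow it. *)
Fixpoint train (y : nat -> coordinate -> K) (uq : q.-tuple 'I_dl) k
    (w : seq 'I_dl) (al : rowarg) : K :=
  if w is c :: w' then
    \sum_i y k (inr (al, i, c)) * train y uq k.+1 w' (inr i)
  else y 0%N (inl (al, uq)).

Lemma train_polyfun uq k w al :
  polyfun (@wcoord K coordinate)
    (fun T => train (fun j => nth (fun=> 0) T j) uq k w al).
Proof.
elim: w k al => [|c w IH] k al /=.
  exact: (polyfun_var (@wcoord K coordinate) (0%N, inl (al, uq))).
apply: polyfun_sum => i; apply: polyfun_mul; last exact: IH.
exact: (polyfun_var (@wcoord K coordinate) (k, inr (al, i, c))).
Qed.

Section Data.
Variables (n : nat) (t : ('I_n -> D) -> K) (L : layout t r p q).

Local Notation tl := (ltensor L).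
Local Notation Minv := (invmx (lblock L)).

Lemma layout_uniq : uniq (pos L).
Proof. by case: L => ? ? ? ? ? ? ? ? ? []. Qed.

Lemma layout_mem i : i \in pos L.
Proof. by case: L => ? ? ? ? ? ? ? ? ? []. Qed.

Lemma size_rowvec i : size (rowvec L i) = p.
Proof. by case: L => ? ? ? ? ? ? ? ? ? []. Qed.

Lemma size_colvec i : size (colvec L i) = q.
Proof. by case: L => ? ? ? ? ? ? ? ? ? []. Qed.

Lemma size_restvec : size (restvec L) = size (restpos L).
Proof. by case: L => ? ? ? ? ? ? ? ? ? []. Qed.

Lemma lblock_det : \det (lblock L) != 0.
Proof. by case: L. Qed.

Lemma size_pos : size (pos L) = (p + (q + size (restpos L)))%N.
Proof. by rewrite !size_cat !size_tuple. Qed.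

Lemma size_pos_ord : size (pos L) = n.
Proof.
by rewrite -(card_uniqP layout_uniq) -[RHS]card_ord; apply: eq_card => i; rewrite layout_mem.
Qed.

Lemma glue_bmix (A : bitseq) (u v : seq D) : size A = n -> size u = n -> size v = n ->
  glue (pos L) (bmix A u v) =
  mix (fun i => nth false A (index i (pos L))) (glue (pos L) u) (glue (pos L) v).
Proof.
by move=> sA su sv; apply: funext => i; rewrite /glue nth_bmix ?sA // /mix; case: ifP.
Qed.

(* The block with rows [rowvec] and columns [colvec] is nonsingular, so it determines
   all entries of the flattening that puts only the position of y on the row side. *)
Lemma layout_schur pre y x2 u v c w : flat_rank_lt t (r + 1) ->
  restvec L = pre ++ y :: x2 -> size u = p -> size v = q -> size w = size x2 ->
  tl (u ++ v ++ pre ++ c :: w) = \sum_i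
    (\sum_j tl (u ++ colvec L j ++ pre ++ c :: x2) * Minv j i) *
    tl (rowvec L i ++ v ++ pre ++ y :: w).
Proof.
move=> rk xE su sv sw.
(* Row side: the row positions and the position of [y]; all other positions are on the column
   side. *)
pose A := nseq p true ++ nseq q false ++ nseq (size pre) false ++ true :: nseq (size x2) false.
have AE u1 u2 v1 v2 c1 c2 w1 w2 :
    size u1 = p -> size u2 = p -> size v1 = q -> size v2 = q ->
    size w1 = size x2 -> size w2 = size x2 ->
    bmix A (u1 ++ v1 ++ pre ++ c1 :: w1) (u2 ++ v2 ++ pre ++ c2 :: w2) =
    u1 ++ v2 ++ pre ++ c1 :: w2.
  move=> su1 su2 sv1 sv2 sw1 sw2.
  rewrite !bmix_cat ?size_nseq // bmix_true // !bmix_false //.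
  by congr (_ ++ (_ ++ (_ ++ (_ :: _)))); exact: bmix_false.
have np : (p + (q + (size pre + (size x2).+1)))%N = n.
  by rewrite -[RHS]size_pos_ord size_pos -size_restvec xE size_cat.
have sz u1 v1 c1 w1 : size u1 = p -> size v1 = q -> size w1 = size x2 ->
    size (u1 ++ v1 ++ pre ++ c1 :: w1) = n.
  by move=> su1 sv1 sw1; rewrite !size_cat /= su1 sv1 sw1.
have sA : size A = n by rewrite !size_cat /= !size_nseq.
pose U := u ++ v ++ pre ++ c :: w.
pose a i := rowvec L i ++ v ++ pre ++ y :: w.
pose b j := u ++ colvec L j ++ pre ++ c :: x2.
have := @flat_rank_schur _ _ _ t r (fun i => nth false A (index i (pos L)))
  (fun i => glue (pos L) (a i)) (fun j => glue (pos L) (b j))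
  (glue (pos L) U) (glue (pos L) U) (rk _).
(* With [y] at its own position this is the block of the layout, whatever [u], [v], [c] and [w]
   are. *)
have -> : flat_block t (fun i => nth false A (index i (pos L)))
  (fun i => glue (pos L) (a i)) (fun j => glue (pos L) (b j)) = lblock L.
  apply/matrixP => i j; rewrite !mxE -glue_bmix ?sz ?size_rowvec ?size_colvec //.
  by rewrite AE ?size_rowvec ?size_colvec // xE.
move=> /(_ lblock_det); rewrite -glue_bmix ?sz // AE // {1}/ltensor => ->.
apply: eq_bigr => i _; rewrite mulr_suml; apply: eq_bigr => j _.
rewrite -!glue_bmix ?sz ?size_rowvec ?size_colvec //.
by rewrite !AE ?size_rowvec ?size_colvec.
Qed.

Definition rowseq (al : rowarg) : seq D :=
  match al with inl w => map e w | inr i => rowvec L i end.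

Lemma size_rowseq al : size (rowseq al) = p.
Proof. by case: al => [w|i]; rewrite /= ?size_map ?size_tuple ?size_rowvec. Qed.

Definition base_letter (c : coordinate) : K :=
  match c with
  | inl (al, uq) => tl (rowseq al ++ map e uq ++ restvec L)
  | inr _ => 0
  end.

(** The coefficients in [layout_schur]: a row of the flattening times the inverse of the block. *)
Definition letter (pre x2 : seq D) (c : coordinate) : K :=
  match c with
  | inl _ => 0
  | inr (al, i, c) =>
      \sum_j tl (rowseq al ++ colvec L j ++ pre ++ e c :: x2) * Minv j i
  end.

Fixpoint letters (pre x2 : seq D) : seq (coordinate -> K) :=
  if x2 is y :: x2' then letter pre x2' :: letters (rcons pre y) x2' else [::].

Lemma size_letters pre x2 : size (letters pre x2) = size x2.
Proof. by elim: x2 pre => //= y x2 IH pre; rewrite IH. Qed.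

(** At a selected position [layout_schur] splits off a letter and leaves a block row with the fixed
    vector in place; an unselected position carries its fixed vector from the start and consumes no
    letter. *)
Lemma train_letters pre x2 b k y (uq : q.-tuple 'I_dl) w al :
  flat_rank_lt t (r + 1) ->
  restvec L = pre ++ x2 -> size b = size x2 -> count id b = size w ->
  (forall j, y (k + j)%N = nth (fun=> 0) (mask b (letters pre x2)) j) ->
  y 0%N = base_letter ->
  tl (rowseq al ++ map e uq ++ pre ++ bmerge b (map e w) x2) = train y uq k w al.
Proof.
move=> rk; elim: x2 pre b k w al => [|z x2 IH] pre [|[] b] k w al //=.
- by move=> xE _ /esym/size0nil -> yk y0; rewrite -xE /= y0.
- move=> xE [sb]; case: w => //= c w; rewrite add1n => -[cb] yk y0.
  rewrite (layout_schur _ rk xE) ?size_rowseq ?size_map ?size_tuple ?size_bmerge ?size_map //.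
  apply: eq_bigr => i _; congr (_ * _); first by rewrite -[X in y X _]addn0 yk.
  rewrite -(IH (rcons pre z) b) //= ?cat_rcons //.
  by move=> j; rewrite addSnnS yk.
- move=> xE [sb]; rewrite add0n => cb yk y0.
  by rewrite -(IH (rcons pre z) b) //= ?cat_rcons.
Qed.

Definition data : seq (coordinate -> K) := base_letter :: letters [::] (restvec L).

Lemma size_data : size data = (size (restpos L)).+1.
Proof. by rewrite /= size_letters size_restvec. Qed.

End Data.

Definition array n (t : ('I_n -> D) -> K) : {ffun 'I_n -> 'I_dl} -> K :=
  fun j => t (fun i => e (j i)).

(* Precomposing a tensor with this map contracts each position j outside the image
   of iota with x j. *)
Definition subst_pos m n (iota : 'I_m -> 'I_n) (x : 'I_n -> D) (v : 'I_m -> D) :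
    'I_n -> D :=
  fun j => if [pick i | iota i == j] is Some i then v i else x j.

(** Of [L] only the positions enter, so letters of another tensor can be inserted. *)
Definition recon n (t : ('I_n -> D) -> K) (L : layout t r p q)
    (T : seq (coordinate -> K)) (j : {ffun 'I_n -> 'I_dl}) : K :=
  train (fun k => nth (fun=> 0) T k) [tuple of map j (colpos L)] 1
    (map j (restpos L)) (inl [tuple of map j (rowpos L)]).

Lemma array_recon n (t : ('I_n -> D) -> K) (L : layout t r p q) :
  flat_rank_lt t (r + 1) -> array t = recon L (data L).
Proof.
move=> rk; apply: funext => j; rewrite /recon.
rewrite -(train_letters (L := L) (pre := [::]) (x2 := restvec L)
  (b := nseq (size (restpos L)) true)) //=.
- rewrite -!map_comp; have -> : bmerge (nseq (size (restpos L)) true)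
      (map (e \o j) (restpos L)) (restvec L) = map (e \o j) (restpos L).
    have := @bmerge_true_cat _ (size (restpos L)) [::] (map (e \o j) (restpos L)) [::]
      (restvec L) [::].
    by rewrite !cats0; apply; rewrite ?size_map ?size_restvec.
  by rewrite -!map_cat /ltensor -/(pos L) glue_map // => i; exact: layout_mem.
- by rewrite size_nseq size_restvec.
- by rewrite count_nseq mul1n size_map.
- by move=> i; rewrite mask_true // size_letters size_restvec.
Qed.

(** Match the positions of [L0] in order with those of [L] kept by the mask, which keeps all row and
    column positions, and contract the others with the fixed vectors of [L]. *)
Lemma array_subst_recon k n (t0 : ('I_k -> D) -> K) (t : ('I_n -> D) -> K)
    (L0 : layout t0 r p q) (L : layout t r p q) b :
  flat_rank_lt t (r + 1) -> size b = size (restpos L) ->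
  count id b = size (restpos L0) ->
  exists iota x, injective iota /\
    array (fun v => t (subst_pos (m := k) iota x v)) = recon L0 (mask (true :: b) (data L)).
Proof.
move=> rk sb cb.
pose B := nseq p true ++ nseq q true ++ b.
pose s := mask B (pos L).
have sB : size B = size (pos L) by rewrite size_pos !size_cat !size_nseq sb.
have cB : count id B = k.
  by rewrite !count_cat !count_nseq !mul1n cb -(size_pos L0) size_pos_ord.
have ss : size s = k by rewrite size_mask.
have sU : uniq s by rewrite mask_uniq ?layout_uniq.
have kn : (k <= n)%N.
  by rewrite -ss -[X in (_ <= X)%N]card_ord cardE uniq_leq_size // => i _; rewrite mem_enum.
have i0 i : (index i (pos L0) < k)%N.
  by rewrite -[X in (_ < X)%N](size_pos_ord L0) index_mem layout_mem.
pose iota i := nth (widen_ord kn i) s (index i (pos L0)).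
have iotaE z i : iota i = nth z s (index i (pos L0)) by apply: set_nth_default; rewrite ss.
(* The zeros only fill row and column positions, which lie in the image of [iota]. *)
pose x := glue (pos L) (nseq p 0 ++ nseq q 0 ++ restvec L).
exists iota, x; split=> [i i'|].
  rewrite (iotaE (widen_ord kn i)) (iotaE (widen_ord kn i) i') => /eqP.
  rewrite nth_uniq ?ss ?i0 // => /eqP ii.
  by rewrite -(nth_index i (layout_mem L0 i)) ii nth_index // layout_mem.
apply: funext => j; rewrite /recon.
rewrite -(train_letters (L := L) (pre := [::]) (x2 := restvec L) (b := b)) //=; first last.
- by rewrite size_map.
- by rewrite size_restvec.
rewrite /array /ltensor; congr (t _).
pose w := map (e \o j) (pos L0).
have -> : [seq e i | i <- [seq j i | i <- rowpos L0]] ++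
    [seq e i | i <- [seq j i | i <- colpos L0]] ++
    bmerge b [seq e i | i <- [seq j i | i <- restpos L0]] (restvec L) =
    bmerge B w (nseq p 0 ++ nseq q 0 ++ restvec L).
  by rewrite -!map_comp /w /pos !map_cat !bmerge_true_cat ?size_map ?size_tuple ?size_nseq.
apply: funext => i; rewrite /subst_pos /glue nth_bmerge ?layout_uniq ?layout_mem //; first last.
- by rewrite cB size_map size_pos_ord.
- by rewrite size_pos !size_cat !size_nseq size_restvec.
rewrite -/s; case: pickP => [i' /eqP <-|nex].
  rewrite (iotaE (iota i')) mem_nth ?ss // index_uniq ?ss //.
  by rewrite (nth_map i') ?size_pos_ord // nth_index // layout_mem.
case: ifPn => // is_.
have : (index i s < k)%N by rewrite -ss index_mem.
rewrite -[X in (_ < X)%N](size_pos_ord L0) => lt.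
have [z _] : exists z, z \in pos L0.
  by case: (pos L0) lt => // z ? _; exists z; rewrite inE eqxx.
have := nex (nth z (pos L0) (index i s)).
by rewrite (iotaE i) index_uniq ?layout_uniq // nth_index // eqxx.
Qed.

End Train.

(** * Noetherianity of tensors of bounded flattening rank *)

Section TensorNoetherian.
Variables (K : fieldType) (K_infinite : infinite_set [set: K]).
Variables (D : vectType K) (dl : nat) (e : 'I_dl -> D).
Local Open Scope ring_scope.

Notation multilin n t := (@multilinear K 'I_n (fun=> D) (K^o : vectType K) t).

Theorem tensors_noetherian r (n : nat -> nat) (t : forall l, ('I_(n l) -> D) -> K)
    (f : forall l, ({ffun 'I_(n l) -> 'I_dl} -> K) -> K) :
  (forall l, multilin (n l) (t l)) -> (forall l, flat_rank_lt (t l) r) ->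
  (forall l, polyfun (fun j s => s j) (f l)) ->
  (forall l, f l (array e (t l)) <> 0) ->
  (forall k l iota x, (k < l)%N -> injective iota ->
     f k (array e (fun v => t l (subst_pos iota x v))) = 0) ->
  False.
Proof.
elim: r n t f => [|r IH] n t f tM rk fP ft fsub.
  have := rk 0%N predT (fun=> fun=> 0) (fun=> fun=> 0).
  by rewrite det_mx00 => /eqP; rewrite oner_eq0.
case: (pselect (forall N, exists2 l, (N <= l)%N & flat_rank_lt (t l) r)) => [H|].
  have [s sI sP] := infinite_subseq H.
  apply: (IH (n \o s) (fun l => t (s l)) (fun l => f (s l)))
    => [l|l|l|l|k l iota x kl]; [exact: tM|exact: sP|exact: fP|exact: ft|].
  exact/fsub/increasing_lt.
move=> /existsNP[N nN].
have lay l : exists v : 'I_r.+1 * 'I_r.+1, inhabited (layout (t (N + l)%N) r v.1 v.2).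
  apply: exists_layout => // rkl; apply: nN; exists (N + l)%N => //.
  exact: leq_addr.
(* Infinitely many layouts share the numbers of row and column positions, so their letters live in
   one space. *)
have [[p q] /infinite_subseq[s sI sP]] := infinite_pigeonhole lay.
pose L l := inhabited_witness (sP l); rewrite /= in L.
pose T l := data e (L l).
have rk1 l : flat_rank_lt (t (N + s l)%N) (r + 1) by rewrite addn1.
apply: (@wide_matrices_noetherian K _ T (fun l S => f (N + s l)%N (recon (L l) S))) => [l|l|l|].
- by rewrite /T size_data.
- apply: (polyfun_comp (h := fun S => recon (L l) S) (fP _)) => j.
  exact: train_polyfun.
- by rewrite -array_recon.
- move=> k l b kl; rewrite !size_data /= => sb cb.
  have [iota [x [iotaI <-]]] := array_subst_recon e (L0 := L k) (L := L l) (rk1 l) sb cb.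
  by apply: fsub => //; rewrite ltn_add2l increasing_lt.
Qed.

End TensorNoetherian.

(** * Closure properties of good Delta-varieties *)

Lemma lfun_linearE (K : fieldType) (U T : vectType K) (h : U -> T) :
  linear h -> forall v, linfun h v = h v.
Proof.
move=> hl v; pose H := GRing.isLinear.Build K U T _ h hl.
pose hL : {linear U -> T} := HB.pack h H.
exact: (lfunE hL v).
Qed.

(** * The basis of a space dual to that of its dual *)

Section Predual.
Variables (K : fieldType) (D : vectType K).
Local Open Scope ring_scope.

Local Notation dl := (\dim {: dual D}).

Definition coorf (a : 'I_(\dim {: D})) : dual D := linfun (coor a : D -> K^o).

Lemma coorfE a v : coorf a v = coor a v.
Proof. by rewrite lfun_linearE // => b x y; rewrite /coor linearP. Qed.

(* The basis of D whose dual basis is [basis : 'I_dl -> dual D]. *)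
Definition predual (c : 'I_dl) : D := \sum_a coor c (coorf a) *: basis a.

Lemma dual_predual (phi : dual D) c : phi (predual c) = coor c phi.
Proof.
have E : phi = \sum_a (phi (basis a) : K) *: coorf a.
  apply/lfunP => v; rewrite sum_lfunE {1}(sum_coor v) linear_sum.
  by apply: eq_bigr => a _; rewrite linearZ !lfunE /= coorfE; apply: mulrC.
rewrite [in RHS]E /predual linear_sum /coor linear_sum; apply: eq_bigr => a _ /=.
by rewrite !linearZ /=; apply: mulrC.
Qed.

Definition dcoor (c : 'I_dl) (v : D) : K := (basis c : dual D) v.

Lemma dcoor_linear c a x y : dcoor c (a *: x + y) = a * dcoor c x + dcoor c y.
Proof. by rewrite /dcoor linearP. Qed.

Lemma predual_sum (v : D) : v = \sum_c dcoor c v *: predual c.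
Proof.
rewrite [LHS]sum_coor [RHS]sum_coor; apply: eq_bigr => a _; congr (_ *: _).
rewrite -!coorfE linear_sum {1}(sum_coor (coorf a)) sum_lfunE.
by apply: eq_bigr => c _; rewrite lfunE linearZ /= dual_predual; apply: mulrC.
Qed.

Lemma dcoor_predual c c' : dcoor c (predual c') = (c' == c)%:R.
Proof. by rewrite /dcoor dual_predual coor_basis. Qed.

Definition extend (T : vectType K) (tau : 'I_dl -> T) : 'Hom(D, T) :=
  linfun (fun v : D => \sum_c dcoor c v *: tau c).

Lemma extendE (T : vectType K) (tau : 'I_dl -> T) v :
  extend tau v = \sum_c dcoor c v *: tau c.
Proof.
rewrite lfun_linearE // => a x y; rewrite scaler_sumr -big_split.
by apply: eq_bigr => c _; rewrite /= dcoor_linear scalerDl scalerA.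
Qed.

Lemma extend_predual (T : vectType K) (tau : 'I_dl -> T) c :
  extend tau (predual c) = tau c.
Proof.
rewrite extendE (bigD1 c) //= big1 ?addr0 => [|c' c'c].
  by rewrite dcoor_predual eqxx scale1r.
by rewrite dcoor_predual eq_sym (negPf c'c) scale0r.
Qed.

End Predual.

(** * Tensors as multilinear functions *)

Section Evaluation.
Variables (K : fieldType) (n : nat) (V : 'I_n -> vectType K).
Local Open Scope ring_scope.

Definition ev_hom (v : forall i, V i) : 'Hom(cotensor V, K^o) :=
  tensor_lift (T := K^o) (fun phi : forall i, dual (V i) => \prod_i phi i (v i)).

Definition ev (t : cotensor V) (v : forall i, V i) : K := ev_hom v t.

Lemma evE (t : cotensor V) v : ev t v = \sum_j (t j : K) * \prod_i dcoor (j i) (v i).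
Proof. by rewrite /ev /ev_hom tensor_liftE. Qed.

Lemma ev_hom_pure (phi : forall i, dual (V i)) v : ev_hom v (pure phi) = \prod_i phi i (v i).
Proof.
rewrite /ev_hom tensor_lift_pure // => {}phi i a x y.
rewrite !(bigD1 i (P := predT)) //= !dfwith_in.
have E (z : dual (V i)) : \prod_(k | k != i) dfwith phi z k (v k) =
    \prod_(k | k != i) phi k (v k).
  by apply: eq_bigr => k ki; rewrite dfwith_out 1?eq_sym.
by rewrite !E !lfunE /= !lfunE /= mulrDl [in RHS]/GRing.scale /= mulrA.
Qed.

Lemma ev_multilinear t : multilinear (ev t : _ -> K^o).
Proof.
move=> v i a x y; rewrite !evE scaler_sumr -big_split; apply: eq_bigr => j _ /=.
rewrite !(bigD1 i (P := predT)) //= !dfwith_in.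
have E (z : V i) : \prod_(k | k != i) dcoor (j k) (dfwith v z k) =
    \prod_(k | k != i) dcoor (j k) (v k).
  by apply: eq_bigr => k ki; rewrite dfwith_out 1?eq_sym.
rewrite !E dcoor_linear /GRing.scale /= mulrDl mulrDr; congr (_ + _).
by rewrite -[X in _ * X = _]mulrA; apply: mulrCA.
Qed.

Lemma ev_sum t v i (J : finType) (a : J -> K) (x : J -> V i) :
  ev t (dfwith v (\sum_j a j *: x j)) = \sum_j a j * ev t (dfwith v (x j)).
Proof. exact: (multilinear_sum v a x (ev_multilinear t)). Qed.

Lemma ev_entry (t : cotensor V) (j : tindex (fun i => dual (V i))) : t j = ev t (fun i => predual (j i)).
Proof.
have E (k : tindex (fun i => dual (V i))) : \prod_i dcoor (k i) (predual (j i)) = (j == k)%:R.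
  have /ffunP/(_ j) := pure_basis (V := fun i => dual (V i)) k; rewrite !ffunE => <-.
  by apply: eq_bigr => i _; rewrite /dcoor dual_predual.
rewrite evE; under eq_bigr do rewrite E; rewrite (bigD1 j) //= eqxx mulr1.
rewrite big1 ?addr0 // => k /negPf kj.
by rewrite eq_sym kj mulr0.
Qed.

Lemma ev_inj s t : (forall v, ev s v = ev t v) -> s = t.
Proof. by move=> st; apply/ffunP => j; rewrite !ev_entry st. Qed.

End Evaluation.

Lemma ev_map (K : fieldType) n (V W : 'I_n -> vectType K)
    (f : forall i, 'Hom(V i, W i)) (t : cotensor W) v :
  ev (cotensor_map f t) v = ev t (fun i => f i (v i)).
Proof.
suff E : ev_hom (fun i => f i (v i)) = (ev_hom v \o cotensor_map f)%VF.
  by rewrite /ev E lfunE.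
apply: tensor_ext => phi; rewrite lfunE /= cotensor_map_pure !ev_hom_pure.
by apply: eq_bigr => i _; rewrite lfunE.
Qed.

(** * Tensor powers of one space and maps of index sets *)

Section Constant.
Variables (K : fieldType) (D : vectType K).
Local Open Scope ring_scope.

Local Notation dl := (\dim {: dual D}).
Local Notation cst n := (fun _ : 'I_n => D).

(** Fuses the factors over each index diagonally and fills the indices outside the image of [p] with
    the covector that is 1 on every [predual c]. *)
Definition pull n n' (p : 'I_n -> 'I_n') (t : cotensor (cst n)) : cotensor (cst n') :=
  [ffun c : tindex (fun _ : 'I_n' => dual D) =>
     t ([ffun i => c (p i)] : tindex (fun _ : 'I_n => dual D))].

Lemma pull_comp n n' n'' (p : 'I_n -> 'I_n') (q : 'I_n' -> 'I_n'') t :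
  pull q (pull p t) = pull (q \o p) t.
Proof. by apply/ffunP => c; rewrite !ffunE; congr (t _); apply/ffunP => i; rewrite !ffunE. Qed.

Lemma pull_id n (p : 'I_n -> 'I_n) t : p =1 id -> pull p t = t.
Proof. by move=> pE; apply/ffunP => c; rewrite !ffunE; congr (t _); apply/ffunP => i; rewrite !ffunE pE. Qed.

Lemma pull_ev n n' (p : 'I_n -> 'I_n') t (c : tindex (fun _ : 'I_n' => dual D)) :
  pull p t c = ev t (fun i => predual (c (p i))).
Proof.
rewrite ffunE ev_entry; congr (ev t _).
by apply: functional_extensionality_dep => i; rewrite ffunE.
Qed.

Lemma pull_perm n (s : 'S_n) t : cotensor_perm (cst n) s t = pull s t.
Proof.
apply/ffunP => c; rewrite pull_ev ev_entry.
suff E v : ev_hom (V := cst n) (fun i => v (s i)) =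
    (ev_hom v \o cotensor_perm (cst n) s)%VF.
  by rewrite /ev (E (fun i => predual (c i))) lfunE.
apply: tensor_ext => phi; rewrite lfunE /=.
pose psi := (fun i => phi ((s^-1)%g i)) : forall i : 'I_n, dual D.
have E2 : phi = fun i => psi (s i).
  by apply: functional_extensionality_dep => i; rewrite /psi permK.
rewrite {2}E2 (cotensor_perm_pure (V := cst n) s psi) !ev_hom_pure.
rewrite [RHS](reindex_inj (@perm_inj _ s)) /=.
by apply: eq_bigr => i _; rewrite /psi permK.
Qed.

Lemma prod_lift_max m (F : 'I_m.+1 -> K) :
  \prod_i F i = (\prod_j F (lift ord_max j)) * F ord_max.
Proof.
rewrite big_ord_recr; congr (_ * _); apply: eq_bigr => j _.
by congr F; apply: val_inj; rewrite /= /bump leqNgt ltn_ord.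
Qed.

Definition collapse m (i : 'I_m.+2) : 'I_m.+1 :=
  if unlift ord_max i is Some j then j else ord_max.

Definition diagonal : 'Hom(D, tensor2 D D) :=
  extend (fun c => pure (V := fun b : bool => if b then D else D)
    (fun b => if b as b return (if b then D else D) then predual c else predual c)).

Definition flat_diagonal m (i : 'I_m.+1) : 'Hom(D, flat_fam (cst m.+2) i).
Proof.
rewrite /flat_fam; case: (unlift ord_max i) => [j|]; [exact: \1%VF|exact: diagonal].
Defined.

Lemma pull_collapse m t :
  cotensor_map (V := cst m.+1) (flat_diagonal (m := m)) (cotensor_flatten (cst m.+2) t) =
  pull (@collapse m) t.
Proof.
apply/ffunP => c; rewrite pull_ev ev_entry ev_map.
suff E : ev_hom (V := cst m.+2) (fun i => predual (c (collapse i))) =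
    (ev_hom (fun i => flat_diagonal i (predual (c i))) \o cotensor_flatten (cst m.+2))%VF.
  by rewrite /ev E lfunE.
apply: tensor_ext => phi; rewrite lfunE /= cotensor_flatten_pure !ev_hom_pure.
rewrite !prod_lift_max -mulrA; congr (_ * _).
  apply: eq_bigr => j _; rewrite /flat_diagonal /flat_duals /flat_fam /collapse !liftK.
  by rewrite lfunE.
rewrite /flat_diagonal /flat_duals /flat_fam /collapse !liftK !unlift_none /diagonal.
by rewrite extend_predual dual_tensor_pure.
Qed.

Definition unit_ones n (i : 'I_n.+1) : 'Hom(D, unit_fam (cst n) i).
Proof.
rewrite /unit_fam; case: (unlift ord_max i) => [j|]; first exact: \1%VF.
exact: (extend (T := K^o) (fun=> 1)).
Defined.

Lemma pull_lift n t :
  cotensor_map (V := cst n.+1) (unit_ones (n := n)) (cotensor_unit (cst n) t) =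
  pull (lift ord_max) t.
Proof.
apply/ffunP => c; rewrite pull_ev ev_entry ev_map.
suff E : ev_hom (V := cst n) (fun i => predual (c (lift ord_max i))) =
    (ev_hom (fun i => unit_ones i (predual (c i))) \o cotensor_unit (cst n))%VF.
  by rewrite /ev E lfunE.
apply: tensor_ext => phi; rewrite lfunE /= cotensor_unit_pure !ev_hom_pure.
rewrite prod_lift_max -[LHS]mulr1; congr (_ * _).
  by apply: eq_bigr => j _; rewrite /unit_ones /unit_duals /unit_fam liftK lfunE.
by rewrite /unit_ones /unit_duals /unit_fam unlift_none extend_predual lfunE.
Qed.

Section Closure.
Variables (Y : rule K) (Y_good : good_delta_variety Y).

Lemma good_map n (V W : 'I_n.+1 -> vectType K) (f : forall i, 'Hom(V i, W i)) t :
  @Y n W t -> @Y n V (cotensor_map f t).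
Proof. by move=> Yt; case: Y_good => [[_ H _ _] _]; apply: (H n V W f); exists t. Qed.

(* Any map of index sets is composed of permutations, fusions of the last two
   indices, and insertions of a last index. *)
Lemma good_pull n n' (p : 'I_n.+1 -> 'I_n'.+1) t :
  @Y _ (cst n.+1) t -> @Y _ (cst n'.+1) (pull p t).
Proof.
have Yperm m (s : 'S_m.+1) u : @Y _ (cst m.+1) u -> @Y _ (cst m.+1) (pull s u).
  move=> Yu; rewrite -pull_perm; case: Y_good => [[_ _ H _] _].
  by apply: (H m (cst m.+1) s); exists u.
have Ycol m u : @Y _ (cst m.+2) u -> @Y _ (cst m.+1) (pull (@collapse m) u).
  move=> Yu; rewrite -pull_collapse; apply: good_map.
  by case: Y_good => [[_ _ _ H] _]; apply: (H m (cst m.+2)); exists u.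
have Ylift m u : @Y _ (cst m.+1) u -> @Y _ (cst m.+2) (pull (lift ord_max) u).
  move=> Yu; rewrite -pull_lift; apply: good_map.
  by case: Y_good => [_ H]; apply: (H m (cst m.+1)); exists u.
have [k] := ubnP (n + n'); elim: k n n' p t => // k IH n n' p t nk Yt.
case: (boolP (injectiveb p)) => [/injectiveP pI|/injectivePn[i [j ij pij]]].
  have := leq_card p pI; rewrite !card_ord ltnS leq_eqVlt => /orP[/eqP nn'|nn'].
    case: n' / nn' p pI {nk} => p pI.
    have -> : pull p t = pull (perm pI) t; last exact: Yperm.
    by apply/ffunP => c; rewrite !ffunE; congr (t _); apply/ffunP => i; rewrite !ffunE permE.
  have [y yP] : exists y, y \notin codom p.
    apply: contrapT => /forallNP H; have : (#|'I_n'.+1| <= #|codom p|)%N.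
      by apply/subset_leq_card/fintype.subsetP => y _; have /negP := H y; rewrite negbK.
    by rewrite card_ord card_codom // card_ord ltnS leqNgt nn'.
  case: n' nn' p pI y yP nk => // m nm p pI y yP nk.
  (* Moving an index outside the image to the end makes the map factor through a smaller index
     set. *)
  pose s := tperm y ord_max.
  have sp x : {z | s (p x) = lift ord_max z}.
    case: (unliftP ord_max (s (p x))) => [z ->|E]; first by exists z.
    exfalso; move: yP; rewrite -(tpermR y ord_max) -/s -E /s tpermK.
    by rewrite codom_f.
  have -> : pull p t = pull s (pull (lift ord_max) (pull (fun x => sval (sp x)) t)).
    rewrite !pull_comp; congr (pull _ t); apply: funext => x /=.
    by rewrite -(svalP (sp x)) tpermK.
  apply/Yperm/Ylift/IH => //; by rewrite addnS ltnS in nk.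
case: n p t i j ij pij nk Yt => [|m] p t i j ij pij nk Yt.
  by rewrite (ord1 i) (ord1 j) eqxx in ij.
(* Move two indices with the same image to the last two places, where they can be fused. *)
pose s1 := tperm j ord_max; pose s : 'S_m.+2 := (s1 * tperm (s1 i) (penult m))%g.
have pm : penult m != ord_max by rewrite eq_sym neq_lift.
have s1i : s1 i != ord_max.
  by apply: contra_neq ij => E; rewrite -(tpermK j ord_max i) -/s1 E tpermR.
have sj : s j = ord_max by rewrite permM tpermL tpermD.
have si : s i = penult m by rewrite permM tpermL.
pose p' (k : 'I_m.+1) := p ((s^-1)%g (lift ord_max k)).
have -> : pull p t = pull p' (pull (@collapse m) (pull s t)).
  rewrite !pull_comp; congr (pull _ t); apply: funext => x /=; rewrite /p' /collapse.
  case: (unliftP ord_max (s x)) => [z E|E]; first by rewrite -E permK.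
  rewrite -[lift _ _]/(penult m) -si permK pij; congr p.
  by apply: (perm_inj (s := s)); rewrite E sj.
apply: IH; last exact/Ycol/Yperm.
by rewrite addSn ltnS in nk.
Qed.

(** The common form of the specializations below: the vector at position [i] depends on the new
    index [p i], and a constant [tau i] contracts the position. *)
Lemma good_substitution n n' (V : 'I_n.+1 -> vectType K) (t : cotensor V)
    (tau : forall i, 'I_dl -> V i) (p : 'I_n.+1 -> 'I_n'.+1) : @Y n V t ->
  exists2 s, @Y _ (cst n'.+1) s & forall c, s c = ev t (fun i => tau i (c (p i))).
Proof.
move=> Yt; exists (pull p (cotensor_map (fun i => extend (tau i)) t)).
  exact/good_pull/good_map.
move=> c; rewrite pull_ev ev_map; congr (ev t _).
by apply: functional_extensionality_dep => i; rewrite extend_predual.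
Qed.

End Closure.

End Constant.

(** * Consequences of boundedness *)

Section Bounded.
Variables (K : fieldType).
Local Open Scope ring_scope.
Local Open Scope classical_set_scope.

Notation dl D := (\dim {: dual D}).
Notation cst D n := (fun _ : 'I_n => D).

Definition pair_index (D : vectType K) (c c' : 'I_(dl D)) :
    tindex (fun _ : 'I_2 => dual D) := [ffun i => if i == ord0 then c else c'].

Lemma ord2_cases (i : 'I_2) : i = ord0 \/ i = ord_max.
Proof. by case: i => [[|[|//]] ?]; [left|right]; apply: val_inj. Qed.

(** A nonsingular [s] is a perfect pairing on [D], so every [y] is the pullback of [s] along the
    identity of [D] and a suitable map from the second space to [D]. *)
Lemma good_full (Y : rule K) (W : 'I_2 -> vectType K) s :
  good_delta_variety Y -> Y 1%N (cst (W ord0) 2) s ->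
  \det (\matrix_(c, c') s (pair_index c c')) != 0 -> Y 1%N W = setT.
Proof.
set D := W ord0 => Yg Ys; set M := (\matrix_(c, c') _) => M0.
have Mu : M \in unitmx by rewrite unitmxE unitfE.
apply/seteqP; split=> // y _.
have o01 : ord0 != ord_max :> 'I_2 by [].
pose b (c : 'I_(dl D)) : forall i, W i :=
  @dfwith _ (fun i => W i : Type) (fun i => 0) ord0 (predual c).
(* Coordinates of [g u], found by solving a linear system with matrix [M] for the values of [y] at
   [u]. *)
pose mu i (u : W i) (c' : 'I_(dl D)) : K := \sum_c invmx M c' c * ev y (dfwith (b c) u).
pose g i : 'Hom(W i, D) := linfun (fun u => \sum_c' mu i u c' *: predual c').
have gE i u : g i u = \sum_c' mu i u c' *: predual c'.
  rewrite lfun_linearE // => a x z; rewrite scaler_sumr -big_split.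
  apply: eq_bigr => c' _ /=; rewrite scalerA -scalerDl; congr (_ *: _).
  rewrite /mu mulr_sumr -big_split; apply: eq_bigr => c _ /=.
  by rewrite ev_multilinear mulrDr [in LHS]/GRing.scale /= mulrCA.
pose f : forall i, 'Hom(W i, D) :=
  @dfwith _ (fun i => 'Hom(W i, D)) g ord0 (\1%VF : 'Hom(D, D)).
suff -> : y = cotensor_map (V := W) (W := cst D 2) f s by apply: good_map.
apply: ev_inj => u; rewrite ev_map.
have f0 : f ord0 (u ord0) = \sum_c dcoor c (u ord0) *: predual c.
  by rewrite /f dfwith_in lfunE /= -predual_sum.
have f1 : f ord_max (u ord_max) = \sum_c' mu ord_max (u ord_max) c' *: predual c'.
  by rewrite /f dfwith_out // gE.
pose v0 : 'I_2 -> D := fun=> 0.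
have -> : (fun i => f i (u i)) =
    dfwith (i := ord_max) (dfwith (i := ord0) v0 (f ord0 (u ord0))) (f ord_max (u ord_max)).
  apply: functional_extensionality_dep => i; case: (ord2_cases i) => ->.
    by rewrite dfwith_out ?dfwith_in.
  by rewrite dfwith_in.
rewrite f1 ev_sum.
have swap (c' : 'I_(dl D)) x : dfwith (i := ord_max) (dfwith (i := ord0) v0 x) (predual c') =
    dfwith (i := ord0) (dfwith (i := ord_max) v0 (predual c')) x.
  apply: functional_extensionality_dep => i; case: (ord2_cases i) => ->.
    by rewrite dfwith_in dfwith_out // dfwith_in.
  by rewrite dfwith_in dfwith_out // dfwith_in.
under eq_bigr => c' _.
  rewrite f0 swap ev_sum.
  over.
have sE c c' : ev s (dfwith (i := ord0) (dfwith (i := ord_max) v0 (predual c')) (predual c)) =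
    M c c'.
  rewrite mxE ev_entry; congr (ev s _).
  apply: functional_extensionality_dep => i; case: (ord2_cases i) => ->.
    by rewrite dfwith_in ffunE eqxx.
  by rewrite dfwith_out // dfwith_in ffunE.
have -> : ev y u = \sum_c dcoor c (u ord0) * ev y (dfwith (b c) (u ord_max)).
  pose v := dfwith (i := ord_max) (fun i => 0 : W i) (u ord_max).
  have {1}-> : u = dfwith (i := ord0) v (\sum_c dcoor c (u ord0) *: predual c).
    apply: functional_extensionality_dep => i; case: (ord2_cases i) => ->.
      by rewrite dfwith_in -predual_sum.
    by rewrite dfwith_out // /v dfwith_in.
  rewrite ev_sum.
  apply: eq_bigr => c _; congr (_ * ev y _).
  apply: functional_extensionality_dep => i; case: (ord2_cases i) => ->.
    by rewrite dfwith_in dfwith_out // /b dfwith_in.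
  by rewrite dfwith_out // /v !dfwith_in.
under [RHS]eq_bigr => c' _ do rewrite mulr_sumr.
rewrite exchange_big /=; apply: eq_bigr => c _.
under [RHS]eq_bigr => c' _ do rewrite sE mulrCA [_ * M c c']mulrC.
rewrite -mulr_sumr; congr (_ * _); rewrite /mu.
under eq_bigr => c' _ do rewrite mulr_sumr.
rewrite exchange_big /= (bigD1 c) //= [X in _ + X]big1 ?addr0 => [|c1 c1c].
  under eq_bigr => c' _ do rewrite mulrA.
  have /matrixP/(_ c c) := mulmxV Mu; rewrite !mxE eqxx -mulr_suml => ->.
  by rewrite mul1r.
under eq_bigr => c' _ do rewrite mulrA.
have /matrixP/(_ c c1) := mulmxV Mu; rewrite !mxE -mulr_suml => ->.
by rewrite eq_sym (negPf c1c) mul0r.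
Qed.

(** Sending the positions in [A] to the first index and the rest to the second turns a nonsingular
    block into an element of [Y] to which [good_full] applies. *)
Lemma bounded_flat_rank (Y : rule K) (W : 'I_2 -> vectType K) :
  good_delta_variety Y -> Y 1%N W <> setT ->
  forall n (V : 'I_n.+1 -> vectType K) t, Y n V t -> flat_rank_lt (ev t) (dl (W ord0)).
Proof.
move=> Yg YW n V t Yt A a b; apply: contrapT => /eqP ab; apply: YW.
pose p i : 'I_2 := if A i then ord0 else ord_max.
pose tau i c := if A i then a c i else b c i.
have [s Ys sE] := good_substitution Yg tau p Yt.
apply: (good_full Yg Ys); suff <- : flat_block (ev t) A a b = \matrix_(c, c') s (pair_index c c') by [].
apply/matrixP => c c'; rewrite !mxE sE; congr (ev t _).
by apply: functional_extensionality_dep => i; rewrite /mix /tau /p !ffunE; case: (A i).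
Qed.

(** A full square would contain the identity matrix. *)
Lemma square_not_full (Y : rule K) (W : 'I_2 -> vectType K) :
  good_delta_variety Y -> Y 1%N W <> setT -> Y 1%N (cst (W ord0) 2) <> setT.
Proof.
move=> Yg YW YD; apply: YW.
pose s : cotensor (cst (W ord0) 2) :=
  [ffun c : tindex (fun _ : 'I_2 => dual (W ord0)) => (c ord0 == c ord_max)%:R].
apply: (good_full (s := s)) => //; first by rewrite YD.
suff -> : \matrix_(c, c') s (pair_index c c') = 1%:M by rewrite det1 oner_neq0.
by apply/matrixP => c c'; rewrite !mxE !ffunE.
Qed.

(** The flattening at position [i] has rank below the dimension of [D], so the vector there can be
    replaced by a combination of that many fixed vectors, with coefficients that pass through
    [D]. *)
Lemma reduce_factor n (V : 'I_n -> vectType K) (D : vectType K) (t : cotensor V) i :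
  flat_rank_lt (ev t) (dl D) -> exists fg : 'Hom(V i, D) * 'Hom(D, V i),
    forall v, ev t (dfwith v (fg.2 (fg.1 (v i)))) = ev t v.
Proof.
move=> rk; pose A := pred1 i.
have [|m mP mmin] := nat_min (P := fun m => forall a b : 'I_m -> forall i, V i,
    \det (flat_block (ev t) A a b) = 0).
  by exists (dl D) => a b; apply: rk.
have md : (m <= dl D)%N by apply: mmin => a b; apply: rk.
case: m mP mmin md => [|r] mP mmin rd.
  have := mP (fun=> fun=> 0) (fun=> fun=> 0).
  by rewrite det_mx00 => /eqP; rewrite oner_eq0.
have /existsNP[a /existsNP[b /eqP ab]] : ~ forall a b : 'I_r -> forall i, V i,
    \det (flat_block (ev t) A a b) = 0.
  by move=> /mmin; rewrite ltnn.
rewrite -addn1 in mP; set M := flat_block _ _ _ _ in ab.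
pose co (x : V i) (k : 'I_r) : K := \sum_j ev t (dfwith (b j) x) * invmx M j k.
pose f := linfun (fun x : V i => \sum_k co x k *: predual (widen_ord (ltnW rd) k)).
pose g : 'Hom(D, V i) := extend (fun c : 'I_(dl D) => oapp (fun k : 'I_r => a k i) 0 (insub (val c))).
exists (f, g) => v /=.
have fE x : f x = \sum_k co x k *: predual (widen_ord (ltnW rd) k).
  rewrite lfun_linearE // => l y z; rewrite scaler_sumr -big_split.
  apply: eq_bigr => k _ /=; rewrite scalerA -scalerDl; congr (_ *: _).
  rewrite /co mulr_sumr -big_split; apply: eq_bigr => j _ /=.
  by rewrite ev_multilinear mulrDl [in LHS]/GRing.scale /= mulrA.
have -> : g (f (v i)) = \sum_k co (v i) k *: a k i.
  rewrite fE linear_sum; apply: eq_bigr => k _; rewrite linearZ /= extend_predual.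
  by rewrite /= (valK k).
rewrite ev_sum.
have mixE (w w' : forall i, V i) : mix A w w' = dfwith w' (w i).
  apply: functional_extensionality_dep => k; rewrite /mix /A /=.
  by case: (eqVneq k i) => [->|ki]; rewrite ?dfwith_in // dfwith_out // eq_sym.
have := flat_rank_schur v v mP ab.
rewrite mixE dfwith_id => ->; apply: eq_bigr => k _.
rewrite /co -mulr_suml mixE; congr (_ * _).
by apply: eq_bigr => j _; rewrite mixE.
Qed.

(** The replacement at one position is valid at all arguments, so it can be made at one position
    after another. *)
Lemma reduce_factors n (V : 'I_n -> vectType K) (D : vectType K) (t : cotensor V) :
  flat_rank_lt (ev t) (dl D) ->
  exists (f : forall i, 'Hom(V i, D)) (g : forall i, 'Hom(D, V i)),
    t = cotensor_map (V := V) (W := cst D n) f (cotensor_map (V := cst D n) g t).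
Proof.
move=> rk; pose fg i := sval (cid (reduce_factor i rk)).
have fgP i v : ev t (dfwith v ((fg i).2 ((fg i).1 (v i)))) = ev t v.
  exact: svalP (cid (reduce_factor i rk)) v.
exists (fun i => (fg i).1), (fun i => (fg i).2); apply: ev_inj => v.
rewrite !ev_map; pose h i x := (fg i).2 ((fg i).1 x).
pose part (s : seq 'I_n) i := if i \in s then h i (v i) else v i.
have -> : (fun i => (fg i).2 ((fg i).1 (v i))) = part (enum 'I_n).
  by apply: functional_extensionality_dep => i; rewrite /part mem_enum.
elim: (enum 'I_n) => //= i s ->.
case: (boolP (i \in s)) => is_.
  congr (ev t _); apply: functional_extensionality_dep => k; rewrite /part inE.
  by case: eqVneq => [->|//]; rewrite is_.
rewrite -(fgP i (part s)); congr (ev t _); apply: functional_extensionality_dep => k.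
case: (eqVneq i k) => [<-|ik]; first by rewrite dfwith_in /part inE eqxx (negPf is_).
by rewrite dfwith_out // /part inE eq_sym (negPf ik).
Qed.

(** The coordinates in which the closed set is given are linear in the entries, so a separating
    polynomial is polynomial in the entries. *)
Lemma closed_separation (D : vectType K) n (X : set (cotensor (cst D n))) t :
  zariski_closed X -> ~ X t ->
  exists F : ({ffun 'I_n -> 'I_(dl D)} -> K) -> K,
    [/\ polyfun (fun j s => s j) F, F (t : {ffun _ -> _}) <> 0 &
      forall s : cotensor (cst D n), X s -> F (s : {ffun _ -> _}) = 0].
Proof.
move=> [P ->] /= /existsNP[p /not_implyP[Pp pt]].
pose F (s : {ffun 'I_n -> 'I_(dl D)} -> K) : K :=
  p.@[fun i => coor i ([ffun j => s j] : cotensor (cst D n))].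
have FE (s : cotensor (cst D n)) : F (s : {ffun _ -> _}) = p.@[fun i => coor i s].
  by apply: meval_eq => i; congr (coor i _); apply/ffunP => j; rewrite ffunE.
exists F; split=> [||s Xs]; [|by rewrite FE|by rewrite FE; apply: Xs].
have -> : F = fun s => \sum_(m <- msupp p) p@_m *
    \prod_i coor i ([ffun j => s j] : cotensor (cst D n)) ^+ m i.
  by apply: funext => s; rewrite /F mevalE.
apply: polyfun_sum => m; apply: polyfun_mul; first exact: polyfun_const.
apply: polyfun_prod => i; apply: polyfun_exp.
have -> : (fun s : {ffun 'I_n -> 'I_(dl D)} -> K =>
    coor i ([ffun j => s j] : cotensor (cst D n))) =
  fun s => \sum_j s j * coor i (pure (V := fun _ : 'I_n => dual D) (fun k => Defs.basis (j k))).
  apply: funext => s; rewrite [X in coor i X](tensor_sum_pure) /coor linear_sum.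
  by apply: eq_bigr => j _; rewrite linearZ /= ffunE.
apply: polyfun_sum => j; apply: polyfun_mul; last exact: polyfun_const.
exact: (polyfun_var (fun j s => s j) j).
Qed.

End Bounded.

(** * An instance that determines a bounded variety *)

Lemma infinite_subseq_dominating (h : nat -> nat) :
  exists2 e, increasing e & forall k l, k < l -> h (e k) <= e l.
Proof.
pose e := fix e l := if l is k.+1 then (e k + h (e k)).+1 else 0.
have eI : increasing e by move=> i; rewrite /= ltnS leq_addr.
exists e => // k l kl; apply: (@leq_trans (e k.+1)); first by rewrite /= ltnW // ltnS leq_addl.
by move: kl; rewrite leq_eqVlt => /orP[/eqP->//|kl]; apply/ltnW/increasing_lt.
Qed.

Local Open Scope classical_set_scope.

Theorem mainTheorem1 (K : fieldType) (K_infinite : infinite_set [set: K])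
    (X : rule K) (X_good : good_delta_variety X) (X_bounded : bounded X) :
  exists (n : nat) (U : 'I_n.+1 -> vectType K),
    largest_rule (fun Y : rule K => good_delta_variety Y /\ Y n U = X n U) X.
Proof.
have [W XW] := X_bounded; pose D := W ord0.
have XD := square_not_full X_good XW.
apply: contrapT => nex.
have counterexample N : exists Z : {Y : rule K & {n : nat & cotensor (fun _ : 'I_n.+1 => D)}},
  let Y := projT1 Z in let n := projT1 (projT2 Z) in let t := projT2 (projT2 Z) in
  [/\ good_delta_variety Y,
      forall k s, (k <= N.+1)%N -> Y k (fun=> D) s -> X k (fun=> D) s,
      Y n (fun=> D) t, ~ X n (fun=> D) t & flat_rank_lt (ev t) (\dim {: dual D})].
  have [Y [Yg YX YnX]] : exists Y : rule K, [/\ good_delta_variety Y,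
      Y N.+1 (fun=> D) = X N.+1 (fun=> D) & ~ delta_sub Y X].
    apply: contrapT => nY; apply: nex; exists N.+1, (fun=> D); split=> // Y [Yg YX].
    by apply: contrapT => nsub; apply: nY; exists Y.
  have YkX k s : (k <= N.+1)%N -> Y k (fun=> D) s -> X k (fun=> D) s.
    move=> kN Ys.
    (* Pad [s] to the N + 2 factors where [Y] and [X] agree, and fuse the added factors again inside
       [X]. *)
    have := good_pull Yg (widen_ord (kN : (k < N.+2)%N)) Ys; rewrite YX => Xs.
    have := good_pull X_good (fun i => inord i : 'I_k.+1) Xs.
    rewrite pull_comp pull_id // => i; apply: val_inj.
    by rewrite /= inordK.
  (* The instance has at least two factors, so on two copies of [D] the bound passes from [X] to
     [Y]. *)
  have YD : Y 1%N (fun=> D) <> setT.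
    move=> YT; apply: XD; apply/seteqP; split=> // s _; apply: YkX => //.
    by rewrite YT.
  move: YnX => /existsNP[n /existsNP[V /existsNP[t /not_implyP[Yt nXt]]]].
  have Yrk := bounded_flat_rank Yg YD.
  (* As [t] is recovered from its pullback to a power of [D], that pullback lies outside [X] too. *)
  have [f [g tE]] := reduce_factors (Yrk _ _ _ Yt).
  have Ys : Y n (fun=> D) (cotensor_map (V := fun=> D) g t) by apply: good_map.
  exists (existT _ Y (existT _ n (cotensor_map (V := fun=> D) g t))); split=> //.
    by move=> Xs; apply: nXt; rewrite tE; apply: good_map.
  exact: Yrk Ys.
have [Z ZP] := choice counterexample.
pose Y N := projT1 (Z N); pose m N := projT1 (projT2 (Z N)).
pose t N := projT2 (projT2 (Z N)).
have sep N : exists F : ({ffun 'I_(m N).+1 -> 'I_(\dim {: dual D})} -> K) -> K,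
    [/\ polyfun (fun j s => s j) F, F (t N : {ffun _ -> _}) <> 0%R &
      forall s, X (m N) (fun=> D) s -> F (s : {ffun _ -> _}) = 0%R].
  apply: closed_separation; last by case: (ZP N).
  by case: X_good => [[H _ _ _] _]; apply: H.
pose F N := sval (cid (sep N)).
have FP N : [/\ polyfun (fun j s => s j) (F N), F N (t N : {ffun _ -> _}) <> 0%R &
      forall s, X (m N) (fun=> D) s -> F N (s : {ffun _ -> _}) = 0%R].
  exact: svalP (cid (sep N)).
(* Thin out so that on the power of [D] carrying an earlier tensor every later [Y] is contained in
   [X]. *)
have [e eI eP] := infinite_subseq_dominating m.
have arrayE n (s : cotensor (fun _ : 'I_n => D)) : array (predual (D := D)) (ev s) = s.
  by apply: funext => j; rewrite [RHS]ev_entry.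
apply: (@tensors_noetherian K K_infinite D _ (predual (D := D)) (\dim {: dual D})
  (fun l => (m (e l)).+1) (fun l => ev (t (e l))) (fun l => F (e l))) => [l|l|l|l|].
- exact: ev_multilinear.
- by case: (ZP (e l)).
- by case: (FP (e l)).
- by rewrite arrayE; case: (FP (e l)).
(* A contraction of the later tensor stays in its [Y], which on the space of the earlier tensor lies
   in [X], where the earlier polynomial vanishes. *)
move=> k l iota x kl iotaI; have [Yg YX Yt _ _] := ZP (e l).
pose p j := if [pick i | iota i == j] is Some i then i else ord0.
pose tau j c := if [pick i | iota i == j] is Some i then predual c else x j.
have [s Ys sE] := good_substitution Yg tau p Yt.
have -> : array (predual (D := D)) (fun v => ev (t (e l)) (subst_pos iota x v)) = s.
  apply: funext => j; rewrite sE; congr (ev _ _); apply: funext => i.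
  by rewrite /subst_pos /tau /p; case: pickP.
have [_ _] := FP (e k); apply; apply: YX Ys; exact: leq_trans (eP k l kl) (leqnSn _).
Qed.
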